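(* Let $b>0$ and let $f\in C^2[-b,b]$ be complex-valued with $f(x)\ne0$ on $[-b,b]$ and $f(0)=1$. Let $\mathbf{R}=(-b,b)\times(-b,b)$, $\overline{\mathbf{R}}=[-b,b]\times[-b,b]$, and let $W$ be a solution of the hyperbolic Vekua equation $$\partial_{\bar z}W-\frac{f'(x)}{2f(x)}\overline W=0$$ admitting a series expansion $W(z)=\sum_{n=0}^\infty Z^{(n)}(a_n,0;z)$, $a_n\in\mathbb{B}$, uniformly convergent in $\overline{\mathbf{R}}$. Then the derivatives $W^{[n]}$ of $W$ in the sense of Bers of any order exist in $\mathbf{R}$, and for the expansion coefficients the Taylor formula holds: $$a_n=\frac{W^{[n]}(0)}{n!},\qquad n=0,1,2,\ldots.$$
   Context: $\mathbb{B}=\{w=u+v\mathbf{j}:u,v\in\mathbb{C}\}$ is the commutative algebra of bicomplex numbers, $\mathbf{j}^2=1$, the complex unit $\mathbf{i}$ commuting with $\mathbf{j}$; $\overline w=u-v\mathbf{j}$; $|w|=\frac12(|u+v|+|u-v|)$. ''Scalar'' means $\mathbb{C}$-valued. The variable is $z=x+t\mathbf{j}$ with $x,t\in\mathbb{R}$; $\partial_z=\frac12(\partial_x+\mathbf{j}\partial_t)$, $\partial_{\bar z}=\frac12(\partial_x-\mathbf{j}\partial_t)$. Solutions are continuously differentiable $\mathbb{B}$-valued functions of $(x,t)$. Bers derivatives: put $(F_n,G_n)=(f,\mathbf{j}/f)$ for even $n$ and $(F_n,G_n)=(1/f,\mathbf{j}f)$ for odd $n$. Set $W^{[0]}=W$;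 writing $W^{[n]}=\varphi F_n+\psi G_n$ with (unique) scalar functions $\varphi,\psi$, define $W^{[n+1]}=(\partial_z\varphi)F_n+(\partial_z\psi)G_n$. Set $X^{(0)}\equiv\widetilde X^{(0)}\equiv1$ and, for $n\ge1$, $$X^{(n)}(x)=n\int_0^xX^{(n-1)}(s)\bigl(f^2(s)\bigr)^{(-1)^n}ds,\qquad \widetilde X^{(n)}(x)=n\int_0^x\widetilde X^{(n-1)}(s)\bigl(f^2(s)\bigr)^{(-1)^{n-1}}ds.$$ Let $\varphi_k=fX^{(k)}$, $\psi_k=\widetilde X^{(k)}/f$ for odd $k$ and $\varphi_k=f\widetilde X^{(k)}$, $\psi_k=X^{(k)}/f$ for even $k$. Put $u_0=\varphi_0(x)$, $v_0=\psi_0(x)$ and, for $m\ge1$, $$u_{2m-1}(x,t)=\sum_{\text{even }k=0}^m\binom mk\varphi_{m-k}(x)t^k,\qquad u_{2m}(x,t)=\sum_{\text{odd }k=1}^m\binom mk\varphi_{m-k}(x)t^k,$$ $$v_{2m-1}(x,t)=\sum_{\text{even }k=0}^m\binom mk\psi_{m-k}(x)t^k,\qquad v_{2m}(x,t)=\sum_{\text{odd }k=1}^m\binom mk\psi_{m-k}(x)t^k.$$ The formal powers with center $0$ and coefficient $a=a'+\mathbf{j}a''$ ($a',a''\in\mathbb{C}$) are $Z^{(0)}(a,0;z)=a'u_0(x,t)+\mathbf{j}a''v_0(x,t)$ and, for $n\ge1$, $$Z^{(n)}(a,0;z)=a'u_{2n-1}(x,t)+a''u_{2n}(x,t)+\mathbf{j}\bigl(a'v_{2n}(x,t)+a''v_{2n-1}(x,t)\bigr).$$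 *)

(* Defs.v *)
(* Real analysis on Stdlib's R, with Coquelicot for derivatives, integrals
   and complex numbers. *)
From Stdlib Require Import Reals Arith.
From Coquelicot Require Import Coquelicot.

Open Scope R_scope.

(** * Bicomplex numbers *)

(** The pair [(u, v)] stands for [u + v j], with [j^2 = 1]. *)
Definition Bicomplex : Type := (C * C)%type.

Definition BC (c : C) : Bicomplex := (c, RtoC 0).
Definition Bj : Bicomplex := (RtoC 0, RtoC 1).

Definition Bplus (w w' : Bicomplex) : Bicomplex :=
  ((fst w + fst w')%C, (snd w + snd w')%C).
Definition Bminus (w w' : Bicomplex) : Bicomplex :=
  ((fst w - fst w')%C, (snd w - snd w')%C).
Definition Bmult (w w' : Bicomplex) : Bicomplex :=
  ((fst w * fst w' + snd w * snd w')%C, (fst w * snd w' + snd w * fst w')%C).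
Definition Bconj (w : Bicomplex) : Bicomplex := (fst w, (- snd w)%C).
Definition Bmod (w : Bicomplex) : R :=
  / 2 * (Cmod (fst w + snd w) + Cmod (fst w - snd w)).

Declare Scope B_scope.
Delimit Scope B_scope with B.
Bind Scope B_scope with Bicomplex.
Infix "+" := Bplus : B_scope.
Infix "-" := Bminus : B_scope.
Infix "*" := Bmult : B_scope.

(** [Bicomplex] as a real normed space; it only serves to speak of
    derivatives and continuity, for which the choice of norm is irrelevant. *)
Definition B_NormedModule : NormedModule R_AbsRing :=
  prod_NormedModule R_AbsRing C_R_NormedModule C_R_NormedModule.

(** * Domains and regularity *)

Definition segment (b x : R) : Prop := - b <= x <= b.
Definition open_square (b x t : R) : Prop := (- b < x < b) /\ (- b < t < b).
Definition closed_square (b x t : R) : Prop := segment b x /\ segment b t.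

(** [df] is the derivative of [f] on [[-b, b]], one-sided at the endpoints;
    the values of [f] and [df] outside the segment are irrelevant. *)
Definition is_derive_on_segment (b : R) (f df : R -> C) : Prop :=
  forall x, segment b x ->
    filterdiff (K := R_AbsRing) (U := R_NormedModule) (V := C_R_NormedModule)
      f (within (segment b) (locally x))
      (fun h : R => scal (V := C_R_NormedModule) h (df x)).

(** [f] is of class [C^2] on [[-b, b]], with [f' = df] and [f'' = ddf]. *)
Definition C2_on_segment (b : R) (f df ddf : R -> C) : Prop :=
  is_derive_on_segment b f df /\ is_derive_on_segment b df ddf /\
  continuous_on (T := R_UniformSpace) (U := C_R_NormedModule) (segment b) ddf.

(** [gx] and [gt] are the partial derivatives of [g] on the open square. *)
Definition has_partials (V : NormedModule R_AbsRing) (b : R)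
    (g gx gt : R -> R -> V) : Prop :=
  forall x t, open_square b x t ->
    is_derive (fun y : R => g y t) x (gx x t) /\
    is_derive (fun s : R => g x s) t (gt x t).

Definition continuous_on_square (V : NormedModule R_AbsRing) (b : R)
    (g : R -> R -> V) : Prop :=
  forall x t, open_square b x t ->
    continuous (T := prod_UniformSpace R_UniformSpace R_UniformSpace) (U := V)
      (fun p : R * R => g (fst p) (snd p)) (x, t).

(** * The hyperbolic Vekua equation *)

(** [d/dz] and [d/d(conj z)] computed from the partial derivatives in [x]
    and [t]. *)
Definition d_z (wx wt : Bicomplex) : Bicomplex :=
  (BC (RtoC (/ 2)) * (wx + Bj * wt))%B.
Definition d_zbar (wx wt : Bicomplex) : Bicomplex :=
  (BC (RtoC (/ 2)) * (wx - Bj * wt))%B.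

Definition Vekua_solution (b : R) (f df : R -> C) (W : R -> R -> Bicomplex)
    : Prop :=
  exists Wx Wt : R -> R -> Bicomplex,
    has_partials B_NormedModule b W Wx Wt /\
    continuous_on_square B_NormedModule b Wx /\
    continuous_on_square B_NormedModule b Wt /\
    forall x t, open_square b x t ->
      (d_zbar (Wx x t) (Wt x t)
       - BC (df x / (RtoC 2 * f x))%C * Bconj (W x t))%B = BC (RtoC 0).

(** * Derivatives in the sense of Bers *)

Definition gen_F (f : R -> C) (n : nat) (x : R) : Bicomplex :=
  if Nat.even n then BC (f x) else BC (/ f x)%C.
Definition gen_G (f : R -> C) (n : nat) (x : R) : Bicomplex :=
  if Nat.even n then (Bj * BC (/ f x)%C)%B else (Bj * BC (f x))%B.

(** [V] is the next Bers derivative of [U], with respect to the [n]-th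
    generating pair, on the open square. *)
Definition is_Bers_step (b : R) (f : R -> C) (n : nat)
    (U V : R -> R -> Bicomplex) : Prop :=
  exists phi psi phi_x phi_t psi_x psi_t : R -> R -> C,
    (forall x t, open_square b x t ->
       U x t = (BC (phi x t) * gen_F f n x + BC (psi x t) * gen_G f n x)%B) /\
    has_partials C_R_NormedModule b phi phi_x phi_t /\
    has_partials C_R_NormedModule b psi psi_x psi_t /\
    (forall x t, open_square b x t ->
       V x t = (d_z (BC (phi_x x t)) (BC (phi_t x t)) * gen_F f n x
                + d_z (BC (psi_x x t)) (BC (psi_t x t)) * gen_G f n x)%B).

(** [V = W^[n]] on the open square.  Since the scalar coefficients of the
    decomposition are unique, such a [V] is unique there. *)
Fixpoint is_Bers_derivative (b : R) (f : R -> C) (W : R -> R -> Bicomplex)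
    (n : nat) (V : R -> R -> Bicomplex) : Prop :=
  match n with
  | O => forall x t, open_square b x t -> V x t = W x t
  | S m => exists U, is_Bers_derivative b f W m U /\ is_Bers_step b f m U V
  end.

(** * Formal powers *)

Definition C_RInt (g : R -> C) (x y : R) : C :=
  RInt (V := C_R_CompleteNormedModule) g x y.

(** [f^2] raised to the power [(-1)^n]. *)
Definition sq_weight (f : R -> C) (n : nat) (s : R) : C :=
  if Nat.even n then (f s ^ 2)%C else (/ (f s ^ 2))%C.

Fixpoint X_pow (f : R -> C) (n : nat) (x : R) : C :=
  match n with
  | O => RtoC 1
  | S m =>
      (RtoC (INR n) * C_RInt (fun s => X_pow f m s * sq_weight f n s)%C 0 x)%C
  end.

Fixpoint Xt_pow (f : R -> C) (n : nat) (x : R) : C :=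
  match n with
  | O => RtoC 1
  | S m =>
      (RtoC (INR n) * C_RInt (fun s => Xt_pow f m s * sq_weight f m s)%C 0 x)%C
  end.

Definition phi_ (f : R -> C) (k : nat) (x : R) : C :=
  if Nat.odd k then (f x * X_pow f k x)%C else (f x * Xt_pow f k x)%C.
Definition psi_ (f : R -> C) (k : nat) (x : R) : C :=
  if Nat.odd k then (Xt_pow f k x / f x)%C else (X_pow f k x / f x)%C.

(** Sums of [binom m k * p_(m-k)(x) * t^k] over the [k <= m] selected by [P]. *)
Definition binom_sum (P : nat -> bool) (p : nat -> R -> C) (m : nat) (x t : R)
    : C :=
  sum_n (fun k => if P k
                  then (RtoC (Binomial.C m k) * p (m - k)%nat x * RtoC (t ^ k))%C
                  else RtoC 0) m.

(** From a sequence [p], the function of index [2m-1] (sum over even [k]),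
    that of index [2m] (sum over odd [k]), and [p_0] at index [0]. *)
Definition wave_pol (p : nat -> R -> C) (n : nat) (x t : R) : C :=
  match n with
  | O => p O x
  | S _ => if Nat.odd n then binom_sum Nat.even p (Nat.div2 (S n)) x t
           else binom_sum Nat.odd p (Nat.div2 n) x t
  end.

Definition u_ (f : R -> C) : nat -> R -> R -> C := wave_pol (phi_ f).
Definition v_ (f : R -> C) : nat -> R -> R -> C := wave_pol (psi_ f).

(** [Z^(n)(a, 0; z)] at [z = x + t j]; [fst a] is [a'] and [snd a] is [a'']. *)
Definition formal_power (f : R -> C) (n : nat) (a : Bicomplex) (x t : R)
    : Bicomplex :=
  match n with
  | O => (BC (fst a * u_ f 0 x t)%C + Bj * BC (snd a * v_ f 0 x t)%C)%B
  | S _ =>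
      (BC (fst a * u_ f (2 * n - 1) x t + snd a * u_ f (2 * n) x t)%C
       + Bj * BC (fst a * v_ f (2 * n) x t + snd a * v_ f (2 * n - 1) x t)%C)%B
  end.

Fixpoint B_partial_sum (w : nat -> Bicomplex) (N : nat) : Bicomplex :=
  match N with
  | O => w O
  | S M => (B_partial_sum w M + w N)%B
  end.

(** The formal power series with coefficients [a] converges to [W] uniformly
    on the closed square. *)
Definition uniform_expansion (b : R) (f : R -> C) (a : nat -> Bicomplex)
    (W : R -> R -> Bicomplex) : Prop :=
  forall eps : R, 0 < eps ->
    exists N0 : nat, forall N : nat, (N0 <= N)%nat ->
      forall x t, closed_square b x t ->
        Bmod (W x t - B_partial_sum (fun n => formal_power f n (a n) x t) N)%B
        < eps.

(* Main.v *)
Require Import Defs.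
From Stdlib Require Import Reals Arith Lra Lia Psatz.
From Coquelicot Require Import Coquelicot.

Open Scope R_scope.
Set Bullet Behavior "Strict Subproofs".

(** Write [phi_k = f A_k] and [psi_k = B_k / f].  The recursive integrals say
    that [A_k' = k B_(k-1) / f^2] and [B_k' = k f^2 A_(k-1)], a system that is
    invariant under the exchange of [(f, A, B)] with [(1/f, B, A)].  With the
    binomial sums [S_n[p](x,t) = sum_k binom n k * p_(n-k)(x) t^k] and the
    coefficients [a' + a''] and [a' - a''], the formal power of degree [n] reads
    [1/2 ((a'+a'') S_n[phi](x,t) + (a'-a'') S_n[phi](x,-t))] in its scalar
    part, with [psi] and a minus sign in its [j] part.  The sums [S_n]
    behave like [(x+t)^n]: differentiating in [t] gives [n S_(n-1)[p]], and
    differentiating in [x] gives [n S_(n-1)] of the other sequence, times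
    [f^2] or [1/f^2].

    If the series may be differentiated term by term, the theorem is a
    computation: a Bers derivative exchanges [A] and [B] and replaces the
    coefficients [c_n] by [(n+1) c_(n+1)] ([bers_series_step]), and at the
    origin only the constant term survives ([bers_series_origin]), as
    [A_k(0) = B_k(0) = 0] for [k > 0].

    The equation is hyperbolic, so uniform convergence does not by itself
    control derivatives; growth of the coefficients does.  On the square
    [|x + t|] comes close to [2b], so what is needed is that the power series
    with coefficients [a' + a''] and [a' - a''] have radius of convergence at
    least [2b].  This rests on [f A_k = x^k (1 + O(1/k))] and the same for
    [B_k / f] ([gs_asymptotics]).  A first order argument bounds [f A_k] by a
    multiple of [|x|^k] ([gs_growth]); then the second order equation
    [(f A_k)'' = f'' A_k + k (k-1) f A_(k-2)] shows that the difference from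
    [x^k] is smaller by a factor [1/k] ([gs_remainder_bound]).  Consequently
    [S_n] is asymptotic to [(2r)^n] at [(r, r)] and negligible with respect to
    it at [(r, -r)] ([appell_asymptotics]); the terms of a uniformly convergent
    series are bounded at these two points, so [|a' + a''| (2r)^n] and
    [|a' - a''| (2r)^n] are bounded for every [r < b]
    ([expansion_coefficients_bounded]).  Together with the bound
    [|S_n| <= K (|x| + |t|)^n] this makes all the series above, and their
    termwise derivatives, converge normally on smaller squares
    ([Cderive_coeff_series]). *)

(** * Complex-valued functions of a real variable *)

Notation Cderive g x l :=
  (is_derive (K := R_AbsRing) (V := C_R_NormedModule) g x l) (only parsing).

Lemma C_ext (z w : C) : fst z = fst w -> snd z = snd w -> z = w.
Proof. destruct z, w; simpl; intros; subst; reflexivity. Qed.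

Lemma Cderive_components (g : R -> C) (x : R) (l : C) :
  Cderive g x l <->
  is_derive (fun y => fst (g y)) x (fst l) /\
  is_derive (fun y => snd (g y)) x (snd l).
Proof.
  split.
  - intros H; split.
    + refine (filterdiff_ext_lin _ _ _ (filterdiff_comp g
        (fst : prod_NormedModule R_AbsRing R_NormedModule R_NormedModule -> R)
        _ _ H (filterdiff_linear _ (is_linear_fst))) _).
      reflexivity.
    + refine (filterdiff_ext_lin _ _ _ (filterdiff_comp g
        (snd : prod_NormedModule R_AbsRing R_NormedModule R_NormedModule -> R)
        _ _ H (filterdiff_linear _ (is_linear_snd))) _).
      reflexivity.
  - intros [H1 H2].
    refine (filterdiff_ext_lin (V := C_R_NormedModule) _ _ _
      (filterdiff_ext (V := C_R_NormedModule) _ _ _ _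
        (filterdiff_comp_2 (W := prod_NormedModule R_AbsRing R_NormedModule R_NormedModule) _ _ (fun u v : R => (u, v)) _ _ (fun u v : R => (u, v)) H1 H2 _)) _).
    + intros y; simpl; destruct (g y); reflexivity.
    + eapply filterdiff_ext_lin; [eapply filterdiff_ext; [| apply filterdiff_id]|].
      intros [u v]; reflexivity.
      intros [u v]; reflexivity.
    + intros y; simpl; destruct l; reflexivity.
Qed.

Lemma Cderive_eq (g : R -> C) (x : R) (l l' : C) :
  Cderive g x l -> l = l' -> Cderive g x l'.
Proof. intros H E; rewrite <- E; exact H. Qed.

Lemma Cderive_const (c : C) (x : R) : Cderive (fun _ => c) x (RtoC 0).
Proof. exact (is_derive_const (V := C_R_NormedModule) c x). Qed.

Lemma Cderive_plus (g h : R -> C) (x : R) (dg dh : C) :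
  Cderive g x dg -> Cderive h x dh ->
  Cderive (fun y => g y + h y)%C x (dg + dh)%C.
Proof. exact (is_derive_plus (V := C_R_NormedModule) g h x dg dh). Qed.

Lemma Cderive_minus (g h : R -> C) (x : R) (dg dh : C) :
  Cderive g x dg -> Cderive h x dh ->
  Cderive (fun y => g y - h y)%C x (dg - dh)%C.
Proof. exact (is_derive_minus (V := C_R_NormedModule) g h x dg dh). Qed.

Lemma Cderive_mult (g h : R -> C) (x : R) (dg dh : C) :
  Cderive g x dg -> Cderive h x dh ->
  Cderive (fun y => g y * h y)%C x (dg * h x + g x * dh)%C.
Proof.
  intros Hg%Cderive_components Hh%Cderive_components.
  destruct Hg as [g1 g2], Hh as [h1 h2]; apply Cderive_components; split; simpl.
  - evar_last; [apply (is_derive_minus (V := R_NormedModule)); apply Derive.is_derive_mult; eassumption|].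
    unfold minus, plus, opp; simpl; ring.
  - evar_last; [apply (is_derive_plus (V := R_NormedModule)); apply Derive.is_derive_mult; eassumption|].
    unfold plus; simpl; ring.
Qed.

Lemma Cderive_scal (c : C) (g : R -> C) (x : R) (dg : C) :
  Cderive g x dg -> Cderive (fun y => c * g y)%C x (c * dg)%C.
Proof.
  intros H; eapply Cderive_eq.
  - apply (Cderive_mult (fun _ => c) g); [apply Cderive_const | exact H].
  - ring.
Qed.

Lemma C_neq_0_norm2 (z : C) : z <> RtoC 0 -> fst z ^ 2 + snd z ^ 2 <> 0.
Proof.
  intros Hz E; apply Hz; destruct z as [u v]; simpl in E; unfold RtoC.
  apply C_ext; simpl; nra.
Qed.

Lemma Cderive_inv (g : R -> C) (x : R) (dg : C) :
  g x <> RtoC 0 -> Cderive g x dg ->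
  Cderive (fun y => / g y)%C x (- dg / (g x * g x))%C.
Proof.
  intros Hx Hg%Cderive_components.
  pose proof (C_neq_0_norm2 _ Hx) as Hn.
  destruct Hg as [g1 g2]; apply Cderive_components.
  assert (Hd : is_derive (fun y => fst (g y) ^ 2 + snd (g y) ^ 2) x
                 (2 * fst (g x) * fst dg + 2 * snd (g x) * snd dg)).
  { evar_last; [apply (is_derive_plus (V := R_NormedModule)); apply is_derive_pow; eassumption|].
    unfold plus; simpl; ring. }
  split; simpl.
  - evar_last; [apply is_derive_div; [exact g1 | exact Hd | exact Hn]|].
    simpl; field; split; [| simpl in Hn]; nra.
  - evar_last; [apply is_derive_div; [exact (is_derive_opp (V := R_NormedModule) (fun y => snd (g y)) x (snd dg) g2) | exact Hd | exact Hn]|].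
    unfold opp; simpl; field; split; [| simpl in Hn]; nra.
Qed.

Lemma Cderive_RtoC (g : R -> R) (x dg : R) :
  is_derive g x dg -> Cderive (fun y => RtoC (g y)) x (RtoC dg).
Proof.
  intros H; apply Cderive_components; split; simpl;
    [exact H | apply (is_derive_const (V := R_NormedModule))].
Qed.

Lemma Cderive_comp (g : R -> C) (h : R -> R) (x dh : R) (dg : C) :
  Cderive g (h x) dg -> is_derive h x dh ->
  Cderive (fun y => g (h y)) x (RtoC dh * dg)%C.
Proof.
  intros Hg Hh.
  eapply Cderive_eq; [exact (is_derive_comp (V := C_R_NormedModule) g h x dg dh Hg Hh)|].
  apply C_ext; simpl; unfold scal; simpl; unfold mult; simpl; ring.
Qed.

Lemma Cderive_continuous (g : R -> C) (x : R) (l : C) :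
  Cderive g x l -> continuous (U := C_R_NormedModule) g x.
Proof. intros H; apply ex_derive_continuous; exists l; exact H. Qed.

Lemma Cmod_C_R_norm (z : C) : norm (V := C_R_NormedModule) z = Cmod z.
Proof.
  unfold norm; simpl; unfold prod_norm, Cmod, norm; simpl; unfold abs; simpl.
  f_equal. rewrite !Rmult_1_r, <- !Rabs_mult, !Rabs_pos_eq; nra.
Qed.

(** The real function whose derivative is compared with zero is the projection
    of [g] on the direction of the increment [g 1 - g 0]; this keeps the bound
    sharp, which componentwise estimates would not. *)
Lemma mean_value_inequality (g g' : R -> C) (M M' : R -> R) :
  (forall s, 0 <= s <= 1 -> Cderive g s (g' s)) ->
  (forall s, 0 <= s <= 1 -> is_derive M s (M' s)) ->
  (forall s, 0 <= s <= 1 -> Cmod (g' s) <= M' s) ->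
  Cmod (g 1 - g 0)%C <= M 1 - M 0.
Proof.
  intros Hg HM Hle.
  set (w := (g 1 - g 0)%C).
  assert (HP : forall u : C, Rabs (fst w * fst u + snd w * snd u) <= Cmod w * Cmod u).
  { intros u. rewrite <- (Cmod_conj w), <- Cmod_mult.
    eapply Rle_trans; [| apply re_le_Cmod].
    right; f_equal; simpl; ring. }
  set (P := fun s => Cmod w * M s - (fst w * fst (g s) + snd w * snd (g s))).
  set (P' := fun s => Cmod w * M' s - (fst w * fst (g' s) + snd w * snd (g' s))).
  assert (HPd : forall s, 0 <= s <= 1 -> is_derive P s (P' s)).
  { intros s Hs. destruct (proj1 (Cderive_components _ _ _) (Hg s Hs)) as [h1 h2].
    apply (is_derive_minus (V := R_NormedModule)).
    - apply (is_derive_scal (fun s => M s)); apply HM, Hs.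
    - apply (is_derive_plus (V := R_NormedModule));
        apply (is_derive_scal (fun s => _ (g s))); assumption. }
  assert (H01 : P 0 <= P 1).
  { destruct (MVT_gen P 0 1 P') as [c [Hc E]].
    - intros x; rewrite Rmin_left, Rmax_right by lra; intros; apply HPd; lra.
    - intros x; rewrite Rmin_left, Rmax_right by lra; intros.
      apply continuity_pt_filterlim, (ex_derive_continuous (V := R_NormedModule)).
      exists (P' x); apply HPd; lra.
    - rewrite Rmin_left, Rmax_right in Hc by lra.
      assert (0 <= P' c); [| lra].
      unfold P'. pose proof (HP (g' c)) as Hp. pose proof (Hle c Hc).
      pose proof (Cmod_ge_0 w). apply Rabs_le_between in Hp. nra. }
  unfold P in H01.
  assert (Hw : fst w * fst (g 1) + snd w * snd (g 1) - (fst w * fst (g 0) + snd w * snd (g 0)) = Cmod w * Cmod w).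
  { unfold Cmod at 1 2; rewrite sqrt_sqrt by nra.
    unfold w; simpl; ring. }
  destruct (Cmod_ge_0 w) as [Hpos | Hz]; [nra|].
  rewrite <- Hz.
  assert (HMM : M 0 <= M 1); [| lra].
  destruct (MVT_gen M 0 1 M') as [c [Hc E]].
  - intros x; rewrite Rmin_left, Rmax_right by lra; intros; apply HM; lra.
  - intros x; rewrite Rmin_left, Rmax_right by lra; intros.
    apply continuity_pt_filterlim, (ex_derive_continuous (V := R_NormedModule)).
    exists (M' x); apply HM; lra.
  - rewrite Rmin_left, Rmax_right in Hc by lra.
    pose proof (Hle c Hc); pose proof (Cmod_ge_0 (g' c)); nra.
Qed.

Lemma increment_bound (g g' : R -> C) (x y L : R) :
  (forall s, Rmin x y <= s <= Rmax x y -> Cderive g s (g' s)) ->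
  (forall s, Rmin x y <= s <= Rmax x y -> Cmod (g' s) <= L) ->
  Cmod (g y - g x)%C <= L * Rabs (y - x).
Proof.
  intros Hg Hle.
  assert (Hb : forall s, 0 <= s <= 1 -> Rmin x y <= x + s * (y - x) <= Rmax x y).
  { intros s Hs; unfold Rmin, Rmax; destruct (Rle_dec x y); nra. }
  pose proof (mean_value_inequality (fun s => g (x + s * (y - x)))
    (fun s => RtoC (y - x) * g' (x + s * (y - x))%R)%C
    (fun s => s * (L * Rabs (y - x))) (fun _ => L * Rabs (y - x))) as H; cbv beta in H.
  replace (x + 1 * (y - x)) with y in H by ring.
  replace (x + 0 * (y - x)) with x in H by ring.
  replace (L * Rabs (y - x)) with (1 * (L * Rabs (y - x)) - 0 * (L * Rabs (y - x))) by ring.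
  apply H; clear H.
  - intros s Hs; apply (Cderive_comp g (fun s => x + s * (y - x))); [apply Hg, Hb, Hs|].
    auto_derive; [exact I | ring].
  - intros s Hs; auto_derive; [exact I | ring].
  - intros s Hs; rewrite Cmod_mult, Cmod_R, Rmult_comm.
    apply Rmult_le_compat_r; [apply Rabs_pos | apply Hle, Hb, Hs].
Qed.

(** Two powers are carried along because that is what the remainders of the
    generating functions satisfy; the case [d = 0] is the plain estimate. *)
Lemma power_increment_bound (g g' : R -> C) (x c d : R) (m : nat) :
  (forall s, Rabs s <= Rabs x -> Cderive g s (g' s)) ->
  (forall s, Rabs s <= Rabs x ->
     Cmod (g' s) <= c * Rabs s ^ m + d * Rabs s ^ S m) ->
  Cmod (g x - g 0)%C <=
    c * Rabs x ^ S m / INR (S m) + d * Rabs x ^ S (S m) / INR (S (S m)).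
Proof.
  intros Hg Hle.
  assert (Hb : forall s, 0 <= s <= 1 -> Rabs (s * x) <= Rabs x).
  { intros s Hs; rewrite Rabs_mult, (Rabs_pos_eq s) by lra.
    pose proof (Rabs_pos x); nra. }
  pose proof (mean_value_inequality (fun s => g (s * x))
    (fun s => RtoC x * g' (s * x)%R)%C
    (fun s => c * Rabs x ^ S m / INR (S m) * s ^ S m
              + d * Rabs x ^ S (S m) / INR (S (S m)) * s ^ S (S m))
    (fun s => c * Rabs x ^ S m * s ^ m + d * Rabs x ^ S (S m) * s ^ S m)) as H; cbv beta in H.
  replace (1 * x) with x in H by ring.
  replace (0 * x) with 0 in H by ring.
  rewrite !pow1, !pow_i, !Rmult_1_r, !Rmult_0_r, Rplus_0_r, Rminus_0_r in H by lia.
  apply H; clear H.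
  - intros s Hs; apply (Cderive_comp g (fun s => s * x)); [apply Hg, Hb, Hs|].
    auto_derive; [exact I | ring].
  - intros s Hs.
    pose proof (lt_0_INR (S m) ltac:(lia)); pose proof (lt_0_INR (S (S m)) ltac:(lia)).
    evar_last.
    + apply (is_derive_plus (V := R_NormedModule));
        apply is_derive_scal, is_derive_pow, is_derive_id.
    + unfold plus, one; simpl pred; simpl; field; split; simpl in *; lra.
  - intros s Hs; rewrite Cmod_mult, Cmod_R.
    eapply Rle_trans; [apply Rmult_le_compat_l; [apply Rabs_pos | apply Hle, Hb, Hs]|].
    rewrite Rabs_mult, (Rabs_pos_eq s), !Rpow_mult_distr by lra.
    right; simpl; ring.
Qed.

Lemma power_bound (g g' : R -> C) (x c d : R) (m : nat) :
  g 0 = RtoC 0 ->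
  (forall s, Rabs s <= Rabs x -> Cderive g s (g' s)) ->
  (forall s, Rabs s <= Rabs x ->
     Cmod (g' s) <= c * Rabs s ^ m + d * Rabs s ^ S m) ->
  Cmod (g x) <=
    c * Rabs x ^ S m / INR (S m) + d * Rabs x ^ S (S m) / INR (S (S m)).
Proof.
  intros H0 Hg Hle; pose proof (power_increment_bound g g' x c d m Hg Hle) as H.
  rewrite H0 in H; replace (g x - RtoC 0)%C with (g x) in H by ring; exact H.
Qed.

(** * The system of recursive integrals *)

Definition locally_bounded (b : R) (g : R -> C) : Prop :=
  forall r, r < b -> exists M, forall x, Rabs x <= r -> Cmod (g x) <= M.

Lemma continuous_locally_bounded (b : R) (g : R -> C) :
  (forall x, - b < x < b -> continuous (U := C_R_NormedModule) g x) ->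
  locally_bounded b g.
Proof.
  intros Hc r Hr.
  destruct (Rlt_or_le r 0) as [Hneg | Hpos].
  { exists 0; intros x Hx; pose proof (Rabs_pos x); lra. }
  destruct (continuity_ab_maj (fun x => norm (V := C_R_NormedModule) (g x)) (- r) r)
    as [m [Hm _]]; [lra | |].
  - intros x Hx; apply continuity_pt_filterlim.
    eapply filterlim_comp; [| apply filterlim_norm].
    apply Hc; lra.
  - exists (norm (V := C_R_NormedModule) (g m)); intros x Hx%Rabs_le_between.
    rewrite <- Cmod_C_R_norm; apply Hm; lra.
Qed.

Lemma locally_bounded_plus (b : R) (g h : R -> C) :
  locally_bounded b g -> locally_bounded b h ->
  locally_bounded b (fun x => g x + h x)%C.
Proof.
  intros Hg Hh r Hr; destruct (Hg r Hr) as [M HM], (Hh r Hr) as [N HN].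
  exists (M + N); intros x Hx.
  eapply Rle_trans; [apply Cmod_triangle|].
  apply Rplus_le_compat; [apply HM | apply HN]; exact Hx.
Qed.

Lemma locally_bounded_mult (b : R) (g h : R -> C) :
  locally_bounded b g -> locally_bounded b h ->
  locally_bounded b (fun x => g x * h x)%C.
Proof.
  intros Hg Hh r Hr; destruct (Hg r Hr) as [M HM], (Hh r Hr) as [N HN].
  exists (M * N); intros x Hx; rewrite Cmod_mult.
  apply Rmult_le_compat; try apply Cmod_ge_0; [apply HM | apply HN]; exact Hx.
Qed.

Lemma locally_bounded_const (b : R) (c : C) : locally_bounded b (fun _ => c).
Proof. intros r _; exists (Cmod c); intros; apply Rle_refl. Qed.

Lemma locally_bounded_ext (b : R) (g h : R -> C) :
  (forall x, - b < x < b -> g x = h x) ->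
  locally_bounded b g -> locally_bounded b h.
Proof.
  intros E Hg r Hr; destruct (Hg r Hr) as [M HM]; exists M.
  intros x Hx; rewrite <- E; [apply HM, Hx|].
  apply Rabs_le_between in Hx; lra.
Qed.

(** The properties of [A] and [B] from which everything else is derived; [f1] and
    [f2] are the first two derivatives of [f].  They are stated abstractly so that
    each estimate on [f A_k] yields one on [B_k / f] by
    [generating_system_dual]; local boundedness of [f2] passes to the dual system
    by algebra alone. *)
Record generating_system (b : R) (f f1 f2 : R -> C) (A B : nat -> R -> C)
  : Prop := {
  gs_derive : forall x, - b < x < b -> Cderive f x (f1 x);
  gs_derive2 : forall x, - b < x < b -> Cderive f1 x (f2 x);
  gs_bounded2 : locally_bounded b f2;
  gs_neq_0 : forall x, - b < x < b -> f x <> RtoC 0;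
  gs_at_0 : f 0 = RtoC 1;
  gs_derive_A : forall k x, - b < x < b ->
    Cderive (A k) x (RtoC (INR k) * B (pred k) x / (f x * f x))%C;
  gs_derive_B : forall k x, - b < x < b ->
    Cderive (B k) x (RtoC (INR k) * A (pred k) x * (f x * f x))%C;
  gs_A_0 : forall x, A O x = RtoC 1;
  gs_B_0 : forall x, B O x = RtoC 1;
  gs_A_at_0 : forall k, A (S k) 0 = RtoC 0;
  gs_B_at_0 : forall k, B (S k) 0 = RtoC 0
}.

Lemma gs_inverse_locally_bounded b f f1 f2 A B :
  generating_system b f f1 f2 A B -> locally_bounded b (fun x => / f x)%C.
Proof.
  intros G; apply continuous_locally_bounded; intros x Hx.
  eapply Cderive_continuous, Cderive_inv;
    [eapply gs_neq_0 | eapply gs_derive]; eassumption.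
Qed.

Lemma gs_derive_locally_bounded b f f1 f2 A B :
  generating_system b f f1 f2 A B -> locally_bounded b f1.
Proof.
  intros G; apply continuous_locally_bounded; intros x Hx.
  eapply Cderive_continuous, gs_derive2; eassumption.
Qed.

Lemma generating_system_dual b f f1 f2 A B :
  generating_system b f f1 f2 A B ->
  generating_system b (fun x => / f x)%C (fun x => - f1 x / (f x * f x))%C
    (fun x => - f2 x / (f x * f x) + RtoC 2 * f1 x * f1 x / (f x * f x * f x))%C
    B A.
Proof.
  intros G; split.
  - intros x Hx; apply Cderive_inv; [eapply gs_neq_0 | eapply gs_derive]; eassumption.
  - intros x Hx. pose proof (gs_neq_0 _ _ _ _ _ _ G x Hx) as Hn.
    pose proof (gs_derive _ _ _ _ _ _ G x Hx) as Hf.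
    eapply Cderive_eq.
    + apply (Cderive_mult (fun y => - f1 y)%C (fun y => / (f y * f y))%C).
      * apply (is_derive_opp (V := C_R_NormedModule)); eapply gs_derive2; eassumption.
      * apply (Cderive_inv (fun y => f y * f y)%C); [apply Cmult_neq_0; assumption|].
        apply Cderive_mult; exact Hf.
    + change (opp (f2 x)) with (- f2 x)%C. field; exact Hn.
  - pose proof (gs_inverse_locally_bounded _ _ _ _ _ _ G) as Hi.
    pose proof (gs_derive_locally_bounded _ _ _ _ _ _ G) as H1.
    pose proof (gs_bounded2 _ _ _ _ _ _ G) as H2.
    apply (locally_bounded_ext b (fun x =>
      - RtoC 1 * (f2 x * (/ f x * / f x))
      + RtoC 2 * (f1 x * (f1 x * (/ f x * (/ f x * / f x)))))%C).
    + intros x Hx; field; eapply gs_neq_0; eassumption.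
    + apply locally_bounded_plus; repeat apply locally_bounded_mult;
        try assumption; apply locally_bounded_const.
  - intros x Hx E; pose proof (gs_neq_0 _ _ _ _ _ _ G x Hx) as Hn.
    apply C1_nz; rewrite <- (Cinv_r (f x) Hn), E; ring.
  - rewrite (gs_at_0 _ _ _ _ _ _ G); field.
  - intros k x Hx; eapply Cderive_eq; [eapply gs_derive_B; eassumption|].
    field; eapply gs_neq_0; eassumption.
  - intros k x Hx; eapply Cderive_eq; [eapply gs_derive_A; eassumption|].
    field; eapply gs_neq_0; eassumption.
  - eapply gs_B_0; eassumption.
  - eapply gs_A_0; eassumption.
  - eapply gs_B_at_0; eassumption.
  - eapply gs_A_at_0; eassumption.
Qed.

Lemma locally_bounded_nonneg (b r : R) (g : R -> C) :
  locally_bounded b g -> r < b ->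
  exists M, 0 <= M /\ forall x, Rabs x <= r -> Cmod (g x) <= M.
Proof.
  intros Hg Hr; destruct (Hg r Hr) as [M HM].
  exists (Rmax 0 M); split; [apply Rmax_l|].
  intros x Hx; eapply Rle_trans; [apply HM, Hx | apply Rmax_r].
Qed.

(** The quotient of [f] at two points is at most [1 + H |x - s|], hence
    exponentially bounded; the exponential is chosen because its factors
    telescope along the recursion of the generating functions. *)
Lemma gs_quotient_bound b f f1 f2 A B r :
  generating_system b f f1 f2 A B -> r < b ->
  exists H, 0 <= H /\ forall x s, Rabs x <= r -> Rabs s <= r ->
    Cmod (f x / f s) <= exp (H * Rabs (x - s)).
Proof.
  intros G Hr.
  destruct (locally_bounded_nonneg _ _ _ (gs_derive_locally_bounded _ _ _ _ _ _ G) Hr) as [L [HL0 HL]].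
  destruct (locally_bounded_nonneg _ _ _ (gs_inverse_locally_bounded _ _ _ _ _ _ G) Hr) as [m [Hm0 Hm]].
  exists (L * m); split; [nra|].
  intros x s Hx Hs.
  assert (Hs' : - b < s < b) by (apply Rabs_le_between in Hs; lra).
  replace (f x / f s)%C with (RtoC 1 + (f x - f s) * / f s)%C
    by (field; eapply gs_neq_0; eassumption).
  eapply Rle_trans; [apply Cmod_triangle|].
  rewrite Cmod_1, Cmod_mult.
  eapply Rle_trans; [| apply exp_ineq1_le].
  apply Rplus_le_compat_l.
  replace (L * m * Rabs (x - s)) with (L * Rabs (x - s) * m) by ring.
  apply Rmult_le_compat; try apply Cmod_ge_0; [| apply Hm, Hs].
  apply Rabs_le_between in Hx; apply Rabs_le_between in Hs.
  apply (increment_bound f f1).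
  - intros u Hu; eapply gs_derive; [eassumption|].
    revert Hu; unfold Rmin, Rmax; destruct (Rle_dec s x); lra.
  - intros u Hu; apply HL, Rabs_le.
    revert Hu; unfold Rmin, Rmax; destruct (Rle_dec s x); lra.
Qed.

(** With [x] fixed, [f(x) A_(k+1)(s)] has derivative
    [(k+1) (f(x)/f(s)) (B_k(s)/f(s))] in [s], so that the exponential factors of
    the quotient and of the hypothesis combine to the constant [exp (H |x|)]. *)
Lemma gs_growth_step b f f1 f2 A B r H k :
  generating_system b f f1 f2 A B -> r < b -> 0 <= H ->
  (forall x s, Rabs x <= r -> Rabs s <= r ->
    Cmod (f x / f s) <= exp (H * Rabs (x - s))) ->
  (forall s, Rabs s <= r -> Cmod (B k s / f s) <= exp (H * Rabs s) * Rabs s ^ k) ->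
  forall x, Rabs x <= r ->
    Cmod (f x * A (S k) x) <= exp (H * Rabs x) * Rabs x ^ S k.
Proof.
  intros G Hr HH Hq IH x Hx.
  pose proof (mean_value_inequality (fun s => f x * A (S k) (s * x)%R)%C
    (fun s => RtoC x * (f x * (RtoC (INR (S k)) * B k (s * x)%R
                               / (f (s * x)%R * f (s * x)%R))))%C
    (fun s => exp (H * Rabs x) * Rabs x ^ S k * s ^ S k)
    (fun s => exp (H * Rabs x) * Rabs x ^ S k * (INR (S k) * s ^ k))) as M.
  cbv beta in M.
  replace (1 * x) with x in M by ring.
  replace (0 * x) with 0 in M by ring.
  rewrite pow1, pow_i, (gs_A_at_0 _ _ _ _ _ _ G), Rmult_1_r, Rmult_0_r, Rminus_0_r in M by lia.
  replace (f x * A (S k) x - f x * 0)%C with (f x * A (S k) x)%C in M by ring.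
  assert (Hb : forall s, 0 <= s <= 1 -> Rabs (s * x) <= r).
  { intros s Hs; rewrite Rabs_mult, (Rabs_pos_eq s) by lra.
    pose proof (Rabs_pos x); nra. }
  assert (Hb' : forall s, 0 <= s <= 1 -> - b < s * x < b).
  { intros s Hs; specialize (Hb s Hs); apply Rabs_le_between in Hb; lra. }
  apply M; clear M.
  - intros s Hs.
    apply (Cderive_comp (fun y => f x * A (S k) y)%C (fun s => s * x)).
    + apply Cderive_scal; exact (gs_derive_A _ _ _ _ _ _ G (S k) _ (Hb' s Hs)).
    + auto_derive; [exact I | ring].
  - intros s Hs; evar_last;
      [apply is_derive_scal, is_derive_pow, is_derive_id|].
    unfold one; simpl pred; simpl; ring.
  - intros s Hs.
    replace (x * (f x * (INR (S k) * B k (s * x)%R / (f (s * x)%R * f (s * x)%R))))%C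
      with (RtoC x * RtoC (INR (S k)) * ((f x / f (s * x)%R) * (B k (s * x)%R / f (s * x)%R)))%C
      by (field; eapply gs_neq_0; [eassumption | apply Hb', Hs]).
    rewrite !Cmod_mult, !Cmod_R, (Rabs_pos_eq (INR _)) by apply pos_INR.
    eapply Rle_trans.
    { apply Rmult_le_compat_l; [apply Rmult_le_pos; [apply Rabs_pos | apply pos_INR]|].
      apply Rmult_le_compat; try apply Cmod_ge_0;
        [apply Hq; [exact Hx | apply Hb, Hs] | apply IH, Hb, Hs]. }
    replace (exp (H * Rabs x)) with (exp (H * Rabs (x - s * x)) * exp (H * Rabs (s * x))).
    + rewrite Rabs_mult, (Rabs_pos_eq s), Rpow_mult_distr by lra.
      right; simpl; ring.
    + rewrite <- exp_plus; f_equal.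
      replace (x - s * x) with ((1 - s) * x) by ring.
      rewrite !Rabs_mult, (Rabs_pos_eq s), (Rabs_pos_eq (1 - s)) by lra; ring.
Qed.

Lemma gs_growth b f f1 f2 A B r :
  generating_system b f f1 f2 A B -> r < b ->
  exists K, 0 <= K /\ forall k x, Rabs x <= r ->
    Cmod (f x * A k x) <= K * Rabs x ^ k.
Proof.
  intros G Hr; pose proof (generating_system_dual _ _ _ _ _ _ G) as G'.
  destruct (gs_quotient_bound _ _ _ _ _ _ _ G Hr) as [H [HH0 HH]].
  assert (HH' : forall x s, Rabs x <= r -> Rabs s <= r ->
    Cmod (/ f x / / f s) <= exp (H * Rabs (x - s))).
  { intros x s Hx Hs. rewrite Rabs_minus_sym.
    replace (/ f x / / f s)%C with (f s / f x)%C; [apply HH; assumption|].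
    apply Rabs_le_between in Hx; apply Rabs_le_between in Hs.
    field; split; (eapply gs_neq_0; [eassumption | lra]). }
  (* The recursion exchanges [A] and [B], so both bounds go by one induction. *)
  assert (Both : forall k x, Rabs x <= r ->
    Cmod (f x * A k x) <= exp (H * Rabs x) * Rabs x ^ k /\
    Cmod (/ f x * B k x) <= exp (H * Rabs x) * Rabs x ^ k).
  { assert (Rabs 0 <= r \/ r < 0) as [H0 | Hneg] by (rewrite Rabs_R0; lra);
      [| intros k x Hx; pose proof (Rabs_pos x); lra].
    induction k as [|k IH]; intros x Hx.
    - pose proof (HH x 0 Hx H0) as E1; pose proof (HH' x 0 Hx H0) as E2.
      rewrite (gs_at_0 _ _ _ _ _ _ G), Rminus_0_r in E1, E2.
      rewrite (gs_A_0 _ _ _ _ _ _ G), (gs_B_0 _ _ _ _ _ _ G), !pow_O, !Rmult_1_r.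
      split; [replace (f x * 1)%C with (f x / 1)%C by field
             | replace (/ f x * 1)%C with (/ f x / / 1)%C]; try assumption.
      field; eapply gs_neq_0; [eassumption|].
      apply Rabs_le_between in Hx; lra.
    - split.
      + apply (gs_growth_step _ _ _ _ _ _ _ _ k G Hr HH0 HH); [| exact Hx].
        intros s Hs; destruct (IH s Hs) as [_ E].
        replace (B k s / f s)%C with (/ f s * B k s)%C; [exact E|].
        unfold Cdiv; ring.
      + apply (gs_growth_step _ _ _ _ _ _ _ _ k G' Hr HH0 HH'); [| exact Hx].
        intros s Hs; destruct (IH s Hs) as [E _].
        replace (A k s / / f s)%C with (f s * A k s)%C; [exact E|].
        field; eapply gs_neq_0; [eassumption|].
        apply Rabs_le_between in Hs; lra. }
  exists (exp (H * r)); split; [left; apply exp_pos|].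
  intros k x Hx; eapply Rle_trans; [apply Both, Hx|].
  apply Rmult_le_compat_r; [apply pow_le, Rabs_pos|].
  destruct (Req_dec (H * Rabs x) (H * r)) as [-> | Hne]; [lra|].
  left; apply exp_increasing; nra.
Qed.

Lemma is_derive_pow_S (k : nat) (x : R) :
  is_derive (fun y => y ^ S k) x (INR (S k) * x ^ k).
Proof.
  evar_last; [apply is_derive_pow, is_derive_id|].
  change (INR (S k) * 1 * x ^ k = INR (S k) * x ^ k); ring.
Qed.

Lemma gs_remainder_derive b f f1 f2 A B k x :
  generating_system b f f1 f2 A B -> - b < x < b ->
  Cderive (fun y => f y * A (S k) y - RtoC (y ^ S k))%C x
    (f1 x * A (S k) x + RtoC (INR (S k)) * B k x / f x
     - RtoC (INR (S k) * x ^ k))%C.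
Proof.
  intros G Hx; eapply Cderive_eq.
  - apply Cderive_minus.
    + apply Cderive_mult; [eapply gs_derive | eapply gs_derive_A]; eassumption.
    + apply Cderive_RtoC, is_derive_pow_S.
  - simpl pred.
    field; eapply gs_neq_0; eassumption.
Qed.

(** [f A_k] satisfies the second order equation
    [y_k'' = (f''/f) y_k + k (k-1) y_(k-2)], whose last term alone would produce
    [x^k]; subtracting [x^k] leaves the first term as the only source. *)
Lemma gs_remainder_derive2 b f f1 f2 A B k x :
  generating_system b f f1 f2 A B -> - b < x < b ->
  Cderive (fun y => f1 y * A (S (S k)) y + RtoC (INR (S (S k))) * B (S k) y / f y
     - RtoC (INR (S (S k)) * y ^ S k))%C x
    (f2 x * A (S (S k)) x
     + RtoC (INR (S (S k)) * INR (S k)) * (f x * A k x - RtoC (x ^ k)))%C.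
Proof.
  intros G Hx; eapply Cderive_eq.
  - apply Cderive_minus; [apply Cderive_plus|].
    + apply Cderive_mult; [eapply gs_derive2 | eapply gs_derive_A]; eassumption.
    + apply (Cderive_mult (fun y => RtoC (INR (S (S k))) * B (S k) y)%C
              (fun y => / f y)%C).
      * apply Cderive_scal; eapply gs_derive_B; eassumption.
      * apply Cderive_inv; [eapply gs_neq_0 | eapply gs_derive]; eassumption.
    + apply Cderive_RtoC.
      exact (is_derive_scal (fun y => y ^ S k) x _ _ (is_derive_pow_S k x)).
  - simpl pred; rewrite !RtoC_mult.
    field; eapply gs_neq_0; eassumption.
Qed.

(** The equation in degree [1], where the source term [k (k-1) y_(k-2)]
    vanishes. *)
Lemma gs_remainder_derive2_1 b f f1 f2 A B x :
  generating_system b f f1 f2 A B -> - b < x < b ->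
  Cderive (fun y => f1 y * A 1%nat y + RtoC (INR 1) * B O y / f y
     - RtoC (INR 1 * y ^ 0))%C x
    (f2 x * A 1%nat x)%C.
Proof.
  intros G Hx; eapply Cderive_eq.
  - apply Cderive_minus; [apply Cderive_plus|].
    + apply Cderive_mult; [eapply gs_derive2 | eapply gs_derive_A]; eassumption.
    + apply (Cderive_mult (fun y => RtoC (INR 1) * B O y)%C (fun y => / f y)%C).
      * apply Cderive_scal; eapply gs_derive_B; eassumption.
      * apply Cderive_inv; [eapply gs_neq_0 | eapply gs_derive]; eassumption.
    + exact (Cderive_const (RtoC (INR 1 * 1)) x).
  - simpl pred; simpl INR. rewrite !(gs_B_0 _ _ _ _ _ _ G).
    field; eapply gs_neq_0; eassumption.
Qed.

(** Integrating [k (k-1) |x|^(k-1) / (k-1)] twice gives [|x|^(k+1) / (k+1)]: the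
    factor [1/(k+1)] reproduces itself along the recursion.  The second power
    absorbs the source [f'' A_k], of size [|x|^k]; it has its own constant because
    merging the two would accumulate a logarithm.  In degree [0] the
    remainder [f - 1] is only [O(|x|)]. *)
Lemma gs_remainder_bound b f f1 f2 A B r :
  generating_system b f f1 f2 A B -> r < b ->
  exists a c, 0 <= a /\ 0 <= c /\ forall k x, Rabs x <= r ->
    Cmod (f x * A k x - RtoC (x ^ k))%C <=
      (a * Rabs x ^ S k + c * Rabs x ^ S (S k)) / INR (S k).
Proof.
  intros G Hr.
  destruct (gs_growth _ _ _ _ _ _ _ G Hr) as [K [HK0 HK]].
  destruct (locally_bounded_nonneg _ _ _ (gs_derive_locally_bounded _ _ _ _ _ _ G) Hr)
    as [L [HL0 HL]].
  destruct (locally_bounded_nonneg _ _ _ (locally_bounded_mult _ _ _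
    (gs_bounded2 _ _ _ _ _ _ G) (gs_inverse_locally_bounded _ _ _ _ _ _ G)) Hr)
    as [Q [HQ0 HQ]].
  exists L, (Q * K / 2); split; [exact HL0 | split; [nra|]].
  assert (Hin : forall x, Rabs x <= r -> - b < x < b)
    by (intros x Hx; apply Rabs_le_between in Hx; lra).
  assert (Hsrc : forall k x, Rabs x <= r ->
            Cmod (f2 x * A k x) <= Q * K * Rabs x ^ k).
  { intros k x Hx.
    replace (f2 x * A k x)%C with ((f2 x * / f x) * (f x * A k x))%C
      by (field; eapply gs_neq_0; [eassumption | apply Hin, Hx]).
    rewrite Cmod_mult, Rmult_assoc.
    apply Rmult_le_compat; try apply Cmod_ge_0; [apply HQ | apply HK]; exact Hx. }
  (* The recursion goes by steps of two. *)
  assert (Pair : forall k,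
    (forall x, Rabs x <= r -> Cmod (f x * A k x - RtoC (x ^ k))%C <=
      (L * Rabs x ^ S k + Q * K / 2 * Rabs x ^ S (S k)) / INR (S k)) /\
    (forall x, Rabs x <= r -> Cmod (f x * A (S k) x - RtoC (x ^ S k))%C <=
      (L * Rabs x ^ S (S k) + Q * K / 2 * Rabs x ^ S (S (S k))) / INR (S (S k)))).
  2: { intros k; apply Pair. }
  induction k as [|k [IH IH']]; (split; [| intros x Hx]).
  - intros x Hx.
    pose proof (power_increment_bound f f1 x L 0 0) as P.
    rewrite (gs_at_0 _ _ _ _ _ _ G) in P.
    rewrite (gs_A_0 _ _ _ _ _ _ G), pow_O, Cmult_1_r.
    eapply Rle_trans; [apply P|].
    + intros s Hs; eapply gs_derive; [eassumption | apply Hin; lra].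
    + intros s Hs; simpl; rewrite Rmult_1_r, Rmult_0_l, Rplus_0_r; apply HL; lra.
    + pose proof (pow_le (Rabs x) 2 (Rabs_pos x)).
      assert (0 <= Q * K / 2 * Rabs x ^ 2) by (apply Rmult_le_pos; nra).
      simpl in *; lra.
  - assert (H1 : forall y, Rabs y <= r ->
      Cmod (f1 y * A 1%nat y + RtoC (INR 1) * B O y / f y - RtoC (INR 1 * y ^ 0))%C
        <= Q * K / 2 * Rabs y ^ 2).
    { intros y Hy.
      eapply Rle_trans;
        [eapply (power_bound
           (fun y => f1 y * A 1%nat y + RtoC (INR 1) * B O y / f y
                     - RtoC (INR 1 * y ^ 0))%C
           (fun y => f2 y * A 1%nat y)%C y (Q * K) 0 1)|].
      - cbv beta; rewrite (gs_A_at_0 _ _ _ _ _ _ G), (gs_B_0 _ _ _ _ _ _ G),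
          (gs_at_0 _ _ _ _ _ _ G); simpl; rewrite Rmult_1_l; field.
      - intros s Hs; eapply gs_remainder_derive2_1; [eassumption | apply Hin; lra].
      - intros s Hs; rewrite Rmult_0_l, Rplus_0_r; apply Hsrc; lra.
      - right; simpl; field. }
    eapply Rle_trans; [eapply (power_bound
      (fun y => f y * A 1%nat y - RtoC (y ^ 1))%C _ x (Q * K / 2) 0 2);
      [cbv beta; rewrite (gs_A_at_0 _ _ _ _ _ _ G); simpl; rewrite Rmult_0_l; ring
      |intros s Hs; apply (gs_remainder_derive _ _ _ _ _ _ 0 s G), Hin; lra
      | intros s Hs; rewrite Rmult_0_l, Rplus_0_r; apply H1; lra]|].
    pose proof (pow_le (Rabs x) 3 (Rabs_pos x)).
    pose proof (pow_le (Rabs x) 2 (Rabs_pos x)).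
    assert (0 <= L * Rabs x ^ 2) by (apply Rmult_le_pos; nra).
    assert (0 <= Q * K / 2 * Rabs x ^ 3) by (apply Rmult_le_pos; nra).
    simpl INR; simpl pow in *; lra.
  - exact IH'.
  - set (c := Q * K / 2) in *.
    pose proof (lt_0_INR (S k) ltac:(lia)) as Hk.
    assert (H1 : forall y, Rabs y <= r ->
      Cmod (f1 y * A (S (S k)) y + RtoC (INR (S (S k))) * B (S k) y / f y
            - RtoC (INR (S (S k)) * y ^ S k))%C
        <= L * Rabs y ^ S (S k)
           + (2 * c + INR (S (S k)) * c) / INR (S (S (S k))) * Rabs y ^ S (S (S k))).
    { intros y Hy.
      eapply Rle_trans;
        [eapply (power_bound
           (fun y => f1 y * A (S (S k)) y + RtoC (INR (S (S k))) * B (S k) y / f y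
                     - RtoC (INR (S (S k)) * y ^ S k))%C
           _ y (INR (S (S k)) * L) (2 * c + INR (S (S k)) * c) (S k))|].
      - cbv beta; rewrite (gs_A_at_0 _ _ _ _ _ _ G), (gs_B_at_0 _ _ _ _ _ _ G),
          (gs_at_0 _ _ _ _ _ _ G), pow_i, Rmult_0_r by lia; field.
      - intros s Hs; apply (gs_remainder_derive2 _ _ _ _ _ _ k s G), Hin; lra.
      - intros s Hs; eapply Rle_trans; [apply Cmod_triangle|].
        assert (Hs' : Rabs s <= r) by lra.
        rewrite (Cmod_mult (RtoC _)), Cmod_R, Rabs_pos_eq
          by (apply Rmult_le_pos; apply pos_INR).
        eapply Rle_trans;
          [apply Rplus_le_compat;
             [apply Hsrc, Hs'
             | apply Rmult_le_compat_l, IH, Hs'; apply Rmult_le_pos; apply pos_INR]|].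
        right; unfold c; field; lra.
      - rewrite !S_INR in *; right; field; lra. }
    eapply Rle_trans; [eapply (power_bound
      (fun y => f y * A (S (S k)) y - RtoC (y ^ S (S k)))%C _ x L
      ((2 * c + INR (S (S k)) * c) / INR (S (S (S k)))) (S (S k)));
      [cbv beta; rewrite (gs_A_at_0 _ _ _ _ _ _ G), pow_i by lia; ring
      |intros s Hs; apply (gs_remainder_derive _ _ _ _ _ _ (S k) s G), Hin; lra
      | intros s Hs; apply H1; lra]|].
    right; rewrite !S_INR in *; field; lra.
Qed.

Lemma gs_asymptotics b f f1 f2 A B r :
  generating_system b f f1 f2 A B -> r < b ->
  exists D, 0 <= D /\ forall k x, Rabs x <= r ->
    Cmod (f x * A k x - RtoC (x ^ k))%C <= D * Rabs x ^ k / INR (S k).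
Proof.
  intros G Hr.
  destruct (Rlt_or_le r 0) as [Hneg | Hpos].
  { exists 0; split; [lra|]; intros k x Hx; pose proof (Rabs_pos x); lra. }
  destruct (gs_remainder_bound _ _ _ _ _ _ _ G Hr) as [a [c [Ha [Hc H]]]].
  exists (a * r + c * (r * r)); split; [nra|].
  intros k x Hx; eapply Rle_trans; [apply H, Hx|].
  unfold Rdiv; apply Rmult_le_compat_r;
    [left; apply Rinv_0_lt_compat, lt_0_INR; lia|].
  simpl; pose proof (pow_le (Rabs x) k (Rabs_pos x)); pose proof (Rabs_pos x).
  replace (a * (Rabs x * Rabs x ^ k) + c * (Rabs x * (Rabs x * Rabs x ^ k)))
    with ((a * Rabs x + c * (Rabs x * Rabs x)) * Rabs x ^ k) by ring.
  apply Rmult_le_compat_r; [assumption|].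
  apply Rplus_le_compat; apply Rmult_le_compat_l; nra.
Qed.

(** * The formal powers form a generating system *)

Lemma locally_open_interval (b x : R) :
  - b < x < b -> locally x (fun y : R => - b < y < b).
Proof.
  intros [H1 H2].
  generalize (filter_and _ _ (open_gt (- b) x H1) (open_lt b x H2)).
  apply filter_imp; intros y [Hy1 Hy2]; split; assumption.
Qed.

Lemma locally_within_segment (b x : R) (P : R -> Prop) :
  - b < x < b -> within (segment b) (locally x) P -> locally x P.
Proof.
  intros Hx HP.
  unfold within in HP.
  generalize (filter_and (F := locally x) _ _ HP (locally_open_interval b x Hx)).
  apply filter_imp; intros y [H Hy]; apply H; unfold segment; lra.
Qed.

Lemma is_derive_on_segment_interior (b : R) (g dg : R -> C) (x : R) :
  is_derive_on_segment b g dg -> - b < x < b -> Cderive g x (dg x).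
Proof.
  intros Hg Hx; destruct (Hg x) as [Hl Hd]; [unfold segment; lra|].
  split; [apply is_linear_scal_l|].
  intros y Hy eps; apply (locally_within_segment b x); [exact Hx|].
  apply Hd; intros P HP.
  specialize (Hy P HP); unfold within; revert Hy.
  apply (filter_imp (F := locally x)); intros z Hz _; exact Hz.
Qed.

Lemma continuous_on_segment_interior (b : R) (g : R -> C) (x : R) :
  continuous_on (T := R_UniformSpace) (U := C_R_NormedModule) (segment b) g ->
  - b < x < b -> continuous (U := C_R_NormedModule) g x.
Proof.
  intros Hg Hx P HP; apply (locally_within_segment b x); [exact Hx|].
  apply (Hg x); [unfold segment; lra | exact HP].
Qed.

Lemma Cderive_C_RInt (b : R) (g : R -> C) (x : R) :
  (forall y, - b < y < b -> continuous (U := C_R_NormedModule) g y) ->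
  - b < x < b -> Cderive (fun y => C_RInt g 0 y) x (g x).
Proof.
  intros Hg Hx.
  apply (is_derive_RInt (V := C_R_NormedModule) g (fun y => C_RInt g 0 y) 0 x).
  - generalize (locally_open_interval b x Hx); apply filter_imp; intros y Hy.
    apply (RInt_correct (V := C_R_CompleteNormedModule)).
    apply (ex_RInt_continuous (V := C_R_CompleteNormedModule)).
    intros z; unfold Rmin, Rmax; destruct (Rle_dec 0 y); intros; apply Hg; lra.
  - apply Hg, Hx.
Qed.

Definition A_pow (f : R -> C) (k : nat) (x : R) : C :=
  if Nat.odd k then X_pow f k x else Xt_pow f k x.
Definition B_pow (f : R -> C) (k : nat) (x : R) : C :=
  if Nat.odd k then Xt_pow f k x else X_pow f k x.

Lemma phi_A_pow f k x : phi_ f k x = (f x * A_pow f k x)%C.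
Proof. unfold phi_, A_pow; destruct (Nat.odd k); reflexivity. Qed.

Lemma psi_B_pow f k x : psi_ f k x = (/ f x * B_pow f k x)%C.
Proof. unfold psi_, B_pow, Cdiv; destruct (Nat.odd k); apply Cmult_comm. Qed.

Lemma X_pow_at_0 f k : X_pow f (S k) 0 = RtoC 0.
Proof.
  simpl X_pow; unfold C_RInt; rewrite RInt_point.
  change (zero : C_R_CompleteNormedModule) with (RtoC 0); ring.
Qed.

Lemma Xt_pow_at_0 f k : Xt_pow f (S k) 0 = RtoC 0.
Proof.
  simpl Xt_pow; unfold C_RInt; rewrite RInt_point.
  change (zero : C_R_CompleteNormedModule) with (RtoC 0); ring.
Qed.

Lemma sq_weight_continuous b f f1 n x :
  (forall y, - b < y < b -> Cderive f y (f1 y)) ->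
  (forall y, - b < y < b -> f y <> RtoC 0) ->
  - b < x < b -> exists l, Cderive (sq_weight f n) x l.
Proof.
  intros Hf Hn Hx.
  pose proof (Cderive_mult _ _ _ _ _ (Hf x Hx) (Hf x Hx)) as H2.
  assert (E : forall y, (f y ^ 2)%C = (f y * f y)%C) by (intros; simpl; ring).
  unfold sq_weight; destruct (Nat.even n); eexists.
  - eapply (is_derive_ext (V := C_R_NormedModule)); [| exact H2].
    intros y; symmetry; apply E.
  - eapply (is_derive_ext (V := C_R_NormedModule));
      [| apply Cderive_inv; [| exact H2]].
    + intros y; cbv beta; rewrite E; reflexivity.
    + apply Cmult_neq_0; apply Hn, Hx.
Qed.

Lemma X_pow_derive b f f1 k x :
  (forall y, - b < y < b -> Cderive f y (f1 y)) ->
  (forall y, - b < y < b -> f y <> RtoC 0) ->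
  - b < x < b ->
  Cderive (X_pow f k) x
    (RtoC (INR k) * (X_pow f (pred k) x * sq_weight f k x))%C.
Proof.
  intros Hf Hn; revert x; induction k as [|k IH]; intros x Hx.
  - eapply Cderive_eq; [apply (Cderive_const (RtoC 1))|]; simpl; ring.
  - apply (Cderive_scal (RtoC (INR (S k)))
      (fun y => C_RInt (fun s => X_pow f k s * sq_weight f (S k) s)%C 0 y)).
    apply (Cderive_C_RInt b (fun s => X_pow f k s * sq_weight f (S k) s)%C);
      [| exact Hx].
    intros y Hy; destruct (sq_weight_continuous b f f1 (S k) y Hf Hn Hy) as [l Hl].
    eapply Cderive_continuous, Cderive_mult; [apply IH, Hy | exact Hl].
Qed.

Lemma Xt_pow_derive b f f1 k x :
  (forall y, - b < y < b -> Cderive f y (f1 y)) ->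
  (forall y, - b < y < b -> f y <> RtoC 0) ->
  - b < x < b ->
  Cderive (Xt_pow f k) x
    (RtoC (INR k) * (Xt_pow f (pred k) x * sq_weight f (pred k) x))%C.
Proof.
  intros Hf Hn; revert x; induction k as [|k IH]; intros x Hx.
  - eapply Cderive_eq; [apply (Cderive_const (RtoC 1))|]; simpl; ring.
  - apply (Cderive_scal (RtoC (INR (S k)))
      (fun y => C_RInt (fun s => Xt_pow f k s * sq_weight f k s)%C 0 y)).
    apply (Cderive_C_RInt b (fun s => Xt_pow f k s * sq_weight f k s)%C);
      [| exact Hx].
    intros y Hy; destruct (sq_weight_continuous b f f1 k y Hf Hn Hy) as [l Hl].
    eapply Cderive_continuous, Cderive_mult; [apply IH, Hy | exact Hl].
Qed.

Lemma formal_powers_generating_system b f df ddf :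
  0 < b -> C2_on_segment b f df ddf ->
  (forall x, segment b x -> f x <> RtoC 0) -> f 0 = RtoC 1 ->
  generating_system b f df ddf (A_pow f) (B_pow f).
Proof.
  intros Hb [Hf [Hdf Hddf]] Hn H1.
  assert (Hf' : forall y, - b < y < b -> Cderive f y (df y))
    by (intros y Hy; apply (is_derive_on_segment_interior b); assumption).
  assert (Hn' : forall y, - b < y < b -> f y <> RtoC 0)
    by (intros y Hy; apply Hn; unfold segment; lra).
  assert (E : forall y, (f y ^ 2)%C = (f y * f y)%C) by (intros; simpl; ring).
  split; try assumption.
  - intros x Hx; apply (is_derive_on_segment_interior b); assumption.
  - apply continuous_locally_bounded; intros x Hx.
    apply (continuous_on_segment_interior b); assumption.
  - intros k x Hx.
    pose proof (X_pow_derive b f df k x Hf' Hn' Hx) as HX.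
    pose proof (Xt_pow_derive b f df k x Hf' Hn' Hx) as HXt.
    destruct k as [|k].
    { eapply Cderive_eq; [apply (Cderive_const (RtoC 1))|]; simpl.
      unfold Cdiv; ring. }
    unfold A_pow, B_pow; simpl pred in *.
    revert HX HXt; unfold sq_weight.
    rewrite Nat.even_succ, Nat.odd_succ, <- Nat.negb_odd, E.
    destruct (Nat.odd k); simpl negb; cbv iota; intros HX HXt;
      [apply (Cderive_eq _ _ _ _ HXt) | apply (Cderive_eq _ _ _ _ HX)];
      unfold Cdiv; ring.
  - intros k x Hx.
    pose proof (X_pow_derive b f df k x Hf' Hn' Hx) as HX.
    pose proof (Xt_pow_derive b f df k x Hf' Hn' Hx) as HXt.
    destruct k as [|k].
    { eapply Cderive_eq; [apply (Cderive_const (RtoC 1))|]; simpl; ring. }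
    unfold A_pow, B_pow; simpl pred in *.
    revert HX HXt; unfold sq_weight.
    rewrite Nat.even_succ, Nat.odd_succ, <- Nat.negb_odd, E.
    destruct (Nat.odd k); simpl negb; cbv iota; intros HX HXt;
      [apply (Cderive_eq _ _ _ _ HX) | apply (Cderive_eq _ _ _ _ HXt)];
      ring.
  - reflexivity.
  - reflexivity.
  - intros k; unfold A_pow; destruct (Nat.odd (S k)); [apply X_pow_at_0 | apply Xt_pow_at_0].
  - intros k; unfold B_pow; destruct (Nat.odd (S k)); [apply Xt_pow_at_0 | apply X_pow_at_0].
Qed.

(** * Binomial sums *)

(** When [p_k(x) = x^k] this is [(x + t)^n]; for the sequences above it is the
    image of that power under the transmutation that sends [x^k] to [p_k]. *)
Definition appell (p : nat -> R -> C) (n : nat) (x t : R) : C :=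
  sum_n (fun k => RtoC (Binomial.C n k) * p (n - k)%nat x * RtoC (t ^ k))%C n.

Lemma C_sum_Sn (u : nat -> C) (n : nat) :
  sum_n u (S n) = (sum_n u n + u (S n))%C :> C.
Proof. exact (sum_Sn u n). Qed.

Lemma C_sum_O (u : nat -> C) : sum_n u 0 = u O :> C.
Proof. exact (sum_O u). Qed.

Lemma C_sum_shift (u : nat -> C) (n : nat) :
  sum_n u (S n) = (u O + sum_n (fun k => u (S k)) n)%C :> C.
Proof.
  induction n as [|n IH].
  - rewrite C_sum_Sn, !C_sum_O; reflexivity.
  - rewrite C_sum_Sn, IH, C_sum_Sn; ring.
Qed.

Lemma C_sum_mult (c : C) (u : nat -> C) (n : nat) :
  sum_n (fun k => c * u k)%C n = (c * sum_n u n)%C :> C.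
Proof.
  induction n as [|n IH]; [rewrite !C_sum_O | rewrite !C_sum_Sn, IH]; ring.
Qed.

Lemma C_sum_plus (u v : nat -> C) (n : nat) :
  sum_n (fun k => u k + v k)%C n = (sum_n u n + sum_n v n)%C :> C.
Proof.
  induction n as [|n IH]; [rewrite !C_sum_O | rewrite !C_sum_Sn, IH]; ring.
Qed.

Lemma C_sum_ext (u v : nat -> C) (n : nat) :
  (forall k, (k <= n)%nat -> u k = v k) -> sum_n u n = sum_n v n :> C.
Proof. intros H; exact (sum_n_ext_loc (G := C_AbelianMonoid) u v n H). Qed.

Lemma Cmod_sum_le (u : nat -> C) (v : nat -> R) (n : nat) :
  (forall k, (k <= n)%nat -> Cmod (u k) <= v k) ->
  Cmod (sum_n u n) <= sum_f_R0 v n.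
Proof.
  induction n as [|n IH]; intros H.
  - rewrite C_sum_O; apply H; lia.
  - rewrite C_sum_Sn; simpl sum_f_R0.
    eapply Rle_trans; [apply Cmod_triangle|].
    apply Rplus_le_compat; [apply IH; intros; apply H | apply H]; lia.
Qed.

Lemma RtoC_sum (u : nat -> R) (n : nat) :
  RtoC (sum_f_R0 u n) = sum_n (fun k => RtoC (u k)) n :> C.
Proof.
  induction n as [|n IH]; [rewrite C_sum_O; reflexivity|].
  rewrite C_sum_Sn, <- IH, <- RtoC_plus; reflexivity.
Qed.

Lemma Cderive_sum (g : nat -> R -> C) (dg : nat -> C) (n : nat) (x : R) :
  (forall k, (k <= n)%nat -> Cderive (g k) x (dg k)) ->
  Cderive (fun y => sum_n (fun k => g k y) n) x (sum_n dg n).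
Proof. exact (is_derive_sum_n (V := C_R_NormedModule) g n x dg). Qed.

Lemma binomial_absorb_lower (n k : nat) : (k <= n)%nat ->
  Binomial.C (S n) (S k) * INR (S k) = INR (S n) * Binomial.C n k.
Proof.
  intros Hk; unfold Binomial.C; rewrite Nat.sub_succ, !fact_simpl, !mult_INR.
  field; repeat split; try apply INR_fact_neq_0; apply not_0_INR; lia.
Qed.

Lemma binomial_absorb_upper (n k : nat) : (k <= n)%nat ->
  Binomial.C (S n) k * INR (S n - k) = INR (S n) * Binomial.C n k.
Proof.
  intros Hk; rewrite pascal_step2 by exact Hk.
  field; apply not_0_INR; lia.
Qed.

Lemma binomial_nonneg (n k : nat) : 0 <= Binomial.C n k.
Proof.
  unfold Binomial.C; apply Rmult_le_pos; [apply pos_INR|].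
  left; apply Rinv_0_lt_compat, Rmult_lt_0_compat; apply INR_fact_lt_0.
Qed.

Lemma appell_derive_t p n x t :
  Cderive (fun s => appell p n x s) t
    (RtoC (INR n) * appell p (pred n) x t)%C.
Proof.
  eapply Cderive_eq.
  - apply (Cderive_sum (fun k s =>
      RtoC (Binomial.C n k) * p (n - k)%nat x * RtoC (s ^ k))%C
      (fun k => RtoC (Binomial.C n k) * p (n - k)%nat x
                * RtoC (INR k * t ^ pred k))%C).
    intros k _; apply Cderive_scal.
    destruct k as [|k].
    + eapply Cderive_eq; [apply (Cderive_const (RtoC 1))|].
      simpl; rewrite Rmult_0_l; reflexivity.
    + exact (Cderive_RtoC _ _ _ (is_derive_pow_S k t)).
  - destruct n as [|n].
    + rewrite C_sum_O; simpl; rewrite Rmult_0_l; ring.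
    + rewrite C_sum_shift; simpl pred; unfold appell.
      rewrite <- C_sum_mult; simpl INR at 1; rewrite Rmult_0_l, Cmult_0_r, Cplus_0_l.
      apply C_sum_ext; intros k Hk.
      rewrite Nat.sub_succ; rewrite <- !Cmult_assoc, (Cmult_assoc (RtoC (INR (S n)))).
      rewrite <- (RtoC_mult (INR (S n))), <- binomial_absorb_lower by exact Hk.
      rewrite !RtoC_mult; ring.
Qed.

Lemma appell_derive_x (p q : nat -> R -> C) (w : C) n x t :
  (forall k, Cderive (p k) x (RtoC (INR k) * q (pred k) x * w)%C) ->
  Cderive (fun y => appell p n y t) x
    (RtoC (INR n) * appell q (pred n) x t * w)%C.
Proof.
  intros Hp; eapply Cderive_eq.
  - apply (Cderive_sum (fun k y =>
      RtoC (Binomial.C n k) * p (n - k)%nat y * RtoC (t ^ k))%C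
      (fun k => w * (RtoC (Binomial.C n k * INR (n - k)) * q (pred (n - k)) x
                * RtoC (t ^ k)))%C).
    intros k _; eapply Cderive_eq.
    + apply (Cderive_mult (fun y => RtoC (Binomial.C n k) * p (n - k)%nat y)%C
        (fun _ => RtoC (t ^ k))); [apply Cderive_scal, Hp | apply Cderive_const].
    + rewrite RtoC_mult; ring.
  - rewrite C_sum_mult, (Cmult_comm _ w); f_equal.
    destruct n as [|n].
    + rewrite C_sum_O; simpl; rewrite Rmult_0_r; ring.
    + rewrite C_sum_Sn, Nat.sub_diag; simpl INR at 2.
      simpl pred at 2; unfold appell; rewrite <- C_sum_mult.
      rewrite Rmult_0_r, !Cmult_0_l, Cplus_0_r.
      apply C_sum_ext; intros k Hk.
      rewrite binomial_absorb_upper, RtoC_mult by exact Hk.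
      rewrite Nat.sub_succ_l by exact Hk; simpl pred; ring.
Qed.

Lemma appell_origin (p : nat -> R -> C) n :
  (forall k, p (S k) 0 = RtoC 0) -> appell p (S n) 0 0 = RtoC 0.
Proof.
  intros Hp; unfold appell.
  rewrite (C_sum_ext _ (fun _ => RtoC 0 * RtoC 0)%C).
  - rewrite C_sum_mult; ring.
  - intros k Hk; destruct k as [|k].
    + simpl; rewrite Hp; ring.
    + rewrite pow_i by lia; ring.
Qed.

Lemma appell_O (p : nat -> R -> C) x t : appell p 0 x t = p O x.
Proof. unfold appell; rewrite C_sum_O, C_n_0; simpl; ring. Qed.

Lemma appell_factor (p q : nat -> R -> C) (c : C) n x t :
  (forall k, p k x = (c * q k x)%C) ->
  appell p n x t = (c * appell q n x t)%C.
Proof.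
  intros Hp; unfold appell; rewrite <- C_sum_mult.
  apply C_sum_ext; intros; rewrite Hp; ring.
Qed.

Lemma appell_bound (p : nat -> R -> C) (K : R) n x t :
  (forall k, Cmod (p k x) <= K * Rabs x ^ k) ->
  Cmod (appell p n x t) <= K * (Rabs x + Rabs t) ^ n.
Proof.
  intros Hp; rewrite (Rplus_comm (Rabs x)), binomial, scal_sum.
  apply Cmod_sum_le; intros k Hk.
  rewrite !Cmod_mult, !Cmod_R, (Rabs_pos_eq (Binomial.C _ _)), <- RPow_abs
    by apply binomial_nonneg.
  replace (Binomial.C n k * Rabs t ^ k * Rabs x ^ (n - k) * K)
    with (Binomial.C n k * (K * Rabs x ^ (n - k)) * Rabs t ^ k) by ring.
  apply Rmult_le_compat_r; [apply pow_le, Rabs_pos|].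
  apply Rmult_le_compat_l; [apply binomial_nonneg | apply Hp].
Qed.

(** Dividing the binomial coefficient by [n - k + 1] turns it into a coefficient
    of order [n + 1], whose sum is [2^(n+1)]; so an error [O(1/k)] in [p_k] gives
    an error [O(1/n)] relative to [(2r)^n]. *)
Lemma appell_asymptotics (p : nat -> R -> C) (D r : R) n x t :
  0 <= D -> Rabs x <= r -> Rabs t <= r ->
  (forall k, Cmod (p k x - RtoC (x ^ k))%C <= D * Rabs x ^ k / INR (S k)) ->
  Cmod (appell p n x t - RtoC ((x + t) ^ n))%C
    <= 2 * D * (2 * r) ^ n / INR (S n).
Proof.
  intros HD Hx Ht Hp.
  pose proof (lt_0_INR (S n) ltac:(lia)) as Hn.
  pose proof (Rabs_pos x) as Hx0.
  replace (appell p n x t - RtoC ((x + t) ^ n))%C with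
    (sum_n (fun k => RtoC (Binomial.C n k) * (p (n - k)%nat x - RtoC (x ^ (n - k)))
                     * RtoC (t ^ k))%C n).
  2: { rewrite (Rplus_comm x), binomial, RtoC_sum.
       match goal with |- _ = (?a - ?s)%C =>
         replace (a - s)%C with (a + - RtoC 1 * s)%C by ring end.
       rewrite <- C_sum_mult; unfold appell; rewrite <- C_sum_plus.
       apply C_sum_ext; intros k Hk; rewrite !RtoC_mult; ring. }
  apply Rle_trans with
    (sum_f_R0 (fun k => Binomial.C (S n) k * (D * r ^ n / INR (S n))) n).
  - apply Cmod_sum_le; intros k Hk.
    rewrite !Cmod_mult, !Cmod_R, (Rabs_pos_eq (Binomial.C _ _)), <- RPow_abs
      by apply binomial_nonneg.
    pose proof (lt_0_INR (S (n - k)) ltac:(lia)) as Hnk.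
    replace (Binomial.C (S n) k) with
      (INR (S n) / INR (S (n - k)) * Binomial.C n k)
      by (rewrite pascal_step2 by exact Hk; rewrite Nat.sub_succ_l by exact Hk; reflexivity).
    replace (r ^ n) with (r ^ (n - k) * r ^ k) by (rewrite <- pow_add; f_equal; lia).
    replace (INR (S n) / INR (S (n - k)) * Binomial.C n k
             * (D * (r ^ (n - k) * r ^ k) / INR (S n)))
      with (Binomial.C n k * (D * r ^ (n - k) / INR (S (n - k))) * r ^ k)
      by (field; lra).
    apply Rmult_le_compat; try apply pow_le, Rabs_pos.
    + apply Rmult_le_pos; [apply binomial_nonneg | apply Cmod_ge_0].
    + apply Rmult_le_compat_l; [apply binomial_nonneg|].
      eapply Rle_trans; [apply Hp|].
      unfold Rdiv; apply Rmult_le_compat_r; [left; apply Rinv_0_lt_compat, Hnk|].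
      apply Rmult_le_compat_l; [exact HD | apply pow_incr; lra].
    + apply pow_incr; split; [apply Rabs_pos | exact Ht].
  - rewrite <- (scal_sum (Binomial.C (S n))).
    pose proof (binomial 1 1 (S n)) as Hb; simpl sum_f_R0 in Hb.
    rewrite (sum_eq _ (Binomial.C (S n))) in Hb
      by (intros; rewrite !pow1; ring).
    pose proof (binomial_nonneg (S n) (S n)).
    rewrite !pow1 in Hb.
    replace (2 * D * (2 * r) ^ n / INR (S n))
      with (D * r ^ n / INR (S n) * (1 + 1) ^ S n)
      by (replace (1 + 1) with 2 by ring;
          rewrite Rpow_mult_distr; simpl pow; field; lra).
    apply Rmult_le_compat_l; [| lra].
    apply Rmult_le_pos; [apply Rmult_le_pos; [exact HD | apply pow_le; lra]|].
    left; apply Rinv_0_lt_compat, Hn.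
Qed.

Lemma pow_opp_parity (t : R) (k : nat) :
  (- t) ^ k = if Nat.even k then t ^ k else - t ^ k.
Proof.
  induction k as [|k IH]; [simpl; reflexivity|].
  rewrite Nat.even_succ, <- Nat.negb_even; simpl pow; rewrite IH.
  destruct (Nat.even k); simpl; ring.
Qed.

(** Even and odd parts in [t]; they trade the alternating definition of the formal
    powers for sums over all [k]. *)
Lemma binom_sum_even p m x t :
  binom_sum Nat.even p m x t
  = (RtoC (/ 2) * (appell p m x t + appell p m x (- t)))%C.
Proof.
  unfold binom_sum, appell; rewrite <- C_sum_plus, <- C_sum_mult.
  apply C_sum_ext; intros k _; rewrite pow_opp_parity, RtoC_inv by lra.
  destruct (Nat.even k); [field | rewrite RtoC_opp; field];
    intros E; apply (f_equal fst) in E; simpl in E; lra.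
Qed.

Lemma binom_sum_odd p m x t :
  binom_sum Nat.odd p m x t
  = (RtoC (/ 2) * (appell p m x t - appell p m x (- t)))%C.
Proof.
  unfold Cminus.
  replace (- appell p m x (- t))%C with (- RtoC 1 * appell p m x (- t))%C
    by ring.
  unfold binom_sum, appell; rewrite <- C_sum_mult, <- C_sum_plus, <- C_sum_mult.
  apply C_sum_ext; intros k _; rewrite pow_opp_parity, <- Nat.negb_even, RtoC_inv by lra.
  destruct (Nat.even k); simpl negb; cbv iota; [| rewrite RtoC_opp]; field;
    intros E; apply (f_equal fst) in E; simpl in E; lra.
Qed.

(** * Series of complex functions *)

Lemma Cderive_eps (g : R -> C) (x : R) (l : C) :
  Cderive g x l <->
  forall eps, 0 < eps -> exists delta, 0 < delta /\
    forall y, Rabs (y - x) < delta ->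
      Cmod (g y - g x - RtoC (y - x) * l)%C <= eps * Rabs (y - x).
Proof.
  assert (Hs : forall y : R, scal (V := C_R_NormedModule) (y - x) l
                      = (RtoC (y - x) * l)%C).
  { intros y; apply C_ext.
    - change ((y - x) * fst l = (y - x) * fst l - 0 * snd l); ring.
    - change ((y - x) * snd l = (y - x) * snd l + 0 * fst l); ring. }
  split.
  - intros [_ Hd] eps Heps.
    destruct (Hd x (fun P HP => HP) (mkposreal eps Heps)) as [delta Hdelta].
    exists delta; split; [apply cond_pos|]; intros y Hy.
    rewrite <- Hs, <- Cmod_C_R_norm; exact (Hdelta y Hy).
  - intros H; split; [apply is_linear_scal_l|].
    intros y Hy; rewrite <- (is_filter_lim_locally_unique _ _ Hy).
    intros eps; destruct (H eps (cond_pos eps)) as [delta [Hdelta Hb]].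
    exists (mkposreal delta Hdelta); intros z Hz.
    specialize (Hb z Hz); rewrite <- Hs, <- Cmod_C_R_norm in Hb; exact Hb.
Qed.

Notation is_Cseries u l :=
  (is_series (K := R_AbsRing) (V := C_R_NormedModule) u l) (only parsing).

Lemma C_sum_components (u : nat -> C) (n : nat) :
  sum_n u n = (sum_n (fun k => fst (u k)) n, sum_n (fun k => snd (u k)) n) :> C.
Proof.
  induction n as [|n IH]; [rewrite C_sum_O, !sum_O; apply surjective_pairing|].
  rewrite C_sum_Sn, IH, !sum_Sn; apply C_ext; reflexivity.
Qed.

Lemma is_Cseries_eps (u : nat -> C) (l : C) :
  is_Cseries u l <->
  forall eps, 0 < eps -> exists N, forall n, (N <= n)%nat ->
    Cmod (sum_n u n - l)%C < eps.
Proof.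
  split.
  - intros H eps Heps.
    destruct (proj1 (filterlim_locally_ball_norm (U := C_R_NormedModule) _ _) H
                (mkposreal eps Heps)) as [N HN].
    exists N; intros n Hn; rewrite <- Cmod_C_R_norm; exact (HN n Hn).
  - intros H; apply (filterlim_locally_ball_norm (U := C_R_NormedModule)).
    intros eps; destruct (H eps (cond_pos eps)) as [N HN].
    exists N; intros n Hn; specialize (HN n Hn).
    rewrite <- Cmod_C_R_norm in HN; exact HN.
Qed.

Lemma is_Cseries_unique (u : nat -> C) (l l' : C) :
  is_Cseries u l -> is_Cseries u l' -> l = l'.
Proof.
  intros H H'.
  exact (filterlim_locally_unique (V := C_R_NormedModule) _ _ _ H H').
Qed.

Definition Csum (u : nat -> C) : C :=
  (Series (fun n => fst (u n)), Series (fun n => snd (u n))).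

Lemma is_Cseries_Csum (u : nat -> C) (M : nat -> R) :
  (forall n, Cmod (u n) <= M n) -> ex_series M -> is_Cseries u (Csum u).
Proof.
  intros Hu HM.
  assert (H1 : is_series (fun n => fst (u n)) (fst (Csum u))).
  { apply Series_correct, (ex_series_le (V := R_CompleteNormedModule) _ M); [|exact HM].
    intros n; eapply Rle_trans; [| apply Hu].
    eapply Rle_trans; [apply Rmax_l | apply Rmax_Cmod]. }
  assert (H2 : is_series (fun n => snd (u n)) (snd (Csum u))).
  { apply Series_correct, (ex_series_le (V := R_CompleteNormedModule) _ M); [|exact HM].
    intros n; eapply Rle_trans; [| apply Hu].
    eapply Rle_trans; [apply Rmax_r | apply Rmax_Cmod]. }
  unfold is_series.
  apply (filterlim_ext (fun n => (sum_n (fun k => fst (u k)) n,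
                                  sum_n (fun k => snd (u k)) n) : C)).
  { intros n; symmetry; apply C_sum_components. }
  rewrite (surjective_pairing (Csum u)).
  intros P [eps HP].
  destruct (proj1 (filterlim_locally _ _) H1 eps) as [N1 HN1].
  destruct (proj1 (filterlim_locally _ _) H2 eps) as [N2 HN2].
  exists (Nat.max N1 N2); intros n Hn; apply HP; split;
    [apply HN1 | apply HN2]; lia.
Qed.

Lemma is_Cseries_bound (u : nat -> C) (M : nat -> R) (l : C) (s : R) :
  (forall n, Cmod (u n) <= M n) -> is_series M s -> is_Cseries u l ->
  Cmod l <= s.
Proof.
  intros Hu HM Hl.
  rewrite <- Cmod_C_R_norm.
  apply (filterlim_le (F := eventually)
    (fun n => norm (V := C_R_NormedModule) (sum_n u n)) (sum_n M) (norm (V := C_R_NormedModule) l) s).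
  - exists O; intros n _.
    eapply Rle_trans; [apply (norm_sum_n_m (V := C_R_NormedModule))|].
    apply (sum_n_m_le _ M); intros k; rewrite Cmod_C_R_norm; apply Hu.
  - eapply filterlim_comp; [exact Hl | apply filterlim_norm].
  - exact HM.
Qed.

Lemma is_Cseries_ext (u v : nat -> C) (l : C) :
  (forall n, u n = v n) -> is_Cseries u l -> is_Cseries v l.
Proof. exact (is_series_ext (V := C_R_NormedModule) u v l). Qed.

Lemma is_Cseries_lincomb (c d : C) (u v : nat -> C) (l l' : C) :
  is_Cseries u l -> is_Cseries v l' ->
  is_Cseries (fun n => c * u n + d * v n)%C (c * l + d * l')%C.
Proof.
  intros Hu Hv.
  pose proof (proj1 (is_Cseries_eps _ _) Hu) as Hu'.
  pose proof (proj1 (is_Cseries_eps _ _) Hv) as Hv'.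
  apply is_Cseries_eps.
  intros eps Heps.
  pose proof (Cmod_ge_0 c); pose proof (Cmod_ge_0 d).
  set (q := eps / (2 * (Cmod c + Cmod d + 1))).
  assert (Hq : 0 < q) by (apply Rdiv_lt_0_compat; lra).
  assert (Eq : (Cmod c + Cmod d + 1) * q = eps / 2) by (unfold q; field; lra).
  destruct (Hu' q Hq) as [N HN], (Hv' q Hq) as [N' HN'].
  exists (Nat.max N N'); intros n Hn.
  specialize (HN n ltac:(lia)); specialize (HN' n ltac:(lia)).
  rewrite C_sum_plus, !C_sum_mult.
  match goal with |- Cmod ?z < _ =>
    replace z with (c * (sum_n u n - l) + d * (sum_n v n - l'))%C by ring end.
  eapply Rle_lt_trans; [apply Cmod_triangle|]; rewrite !Cmod_mult.
  assert (Cmod c * Cmod (sum_n u n - l)%C <= Cmod c * q)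
    by (apply Rmult_le_compat_l; lra).
  assert (Cmod d * Cmod (sum_n v n - l')%C <= Cmod d * q)
    by (apply Rmult_le_compat_l; lra).
  nra.
Qed.

Lemma is_Cseries_scal (c : C) (u : nat -> C) (l : C) :
  is_Cseries u l -> is_Cseries (fun n => c * u n)%C (c * l)%C.
Proof.
  intros H.
  replace (c * l)%C with (c * l + RtoC 0 * l)%C by ring.
  apply (is_Cseries_ext (fun n => c * u n + RtoC 0 * u n)%C).
  - intros n; ring.
  - apply is_Cseries_lincomb; exact H.
Qed.

Lemma is_Cseries_cons_0 (u : nat -> C) (l : C) :
  u O = RtoC 0 -> is_Cseries (fun n => u (S n)) l -> is_Cseries u l.
Proof.
  intros H0 H; apply (is_series_decr_1 (V := C_R_NormedModule)).
  refine (eq_ind l (fun z => is_Cseries (fun n => u (S n)) z) H _ _).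
  change (l = (l + - u O)%C); rewrite H0; ring.
Qed.

(** Termwise differentiation.  The finite head of the series is differentiated
    exactly; in the tail, the increment of each term is controlled by the bound
    on its derivative. *)
Lemma Cderive_series (g g' : nat -> R -> C) (G : R -> C) (l : C)
    (M : nat -> R) (x delta : R) :
  0 < delta ->
  (forall n y, Rabs (y - x) < delta -> Cderive (g n) y (g' n y)) ->
  (forall n y, Rabs (y - x) < delta -> Cmod (g' n y) <= M n) ->
  ex_series M ->
  (forall y, Rabs (y - x) < delta -> is_Cseries (fun n => g n y) (G y)) ->
  is_Cseries (fun n => g' n x) l ->
  Cderive G x l.
Proof.
  intros Hdelta Hd Hb HM HG Hl; apply Cderive_eps; intros eps Heps.
  assert (Hxx : Rabs (x - x) < delta)
    by (rewrite Rminus_diag_eq, Rabs_R0 by reflexivity; exact Hdelta).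
  assert (Heps4 : 0 < eps / 4) by lra.
  destruct (proj1 (filterlim_locally _ _) (Series_correct _ HM)
              (mkposreal (eps / 4) Heps4)) as [N HN].
  specialize (HN N (le_n N)).
  assert (Htail : is_series (fun n => M (S N + n)%nat) (Series M - sum_n M N)).
  { apply (is_series_incr_n (V := R_NormedModule)); [lia|]; simpl pred.
    refine (eq_ind _ (fun z => is_series M z) (Series_correct _ HM) _ _).
    change (Series M = Series M - sum_n M N + sum_n M N); ring. }
  assert (Hsmall : Series M - sum_n M N <= eps / 4).
  { change (Rabs (sum_n M N - Series M) < eps / 4) in HN.
    apply Rabs_def2 in HN; lra. }
  assert (Hhead : Cderive (fun y => sum_n (fun k => g k y) N) x
                    (sum_n (fun k => g' k x) N))
    by (apply Cderive_sum; intros k _; apply Hd, Hxx).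
  destruct (proj1 (Cderive_eps _ _ _) Hhead (eps / 2) ltac:(lra))
    as [delta' [Hdelta' Hhead']].
  exists (Rmin delta delta'); split; [apply Rmin_glb_lt; assumption|].
  intros y Hy.
  assert (Hy1 : Rabs (y - x) < delta) by (eapply Rlt_le_trans; [exact Hy | apply Rmin_l]).
  assert (Hy2 : Rabs (y - x) < delta') by (eapply Rlt_le_trans; [exact Hy | apply Rmin_r]).
  set (h := fun n => (g n y - g n x - RtoC (y - x) * g' n x)%C).
  assert (Hh : is_Cseries h (G y - G x - RtoC (y - x) * l)%C).
  { pose proof (is_Cseries_lincomb (RtoC 1) (- RtoC 1)%C _ _ _ _
                  (HG y Hy1) (HG x Hxx)) as H1.
    pose proof (is_Cseries_lincomb (RtoC 1) (- RtoC (y - x))%C _ _ _ _ H1 Hl) as H2.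
    replace (G y - G x - RtoC (y - x) * l)%C with
      (1 * (1 * G y + - (1) * G x) + - RtoC (y - x) * l)%C by ring.
    revert H2; apply is_Cseries_ext; intros n; unfold h; ring. }
  assert (Hterm : forall n, Cmod (h n) <= 2 * Rabs (y - x) * M n).
  { intros n; unfold h, Cminus at 1.
    eapply Rle_trans; [apply Cmod_triangle|]; rewrite Cmod_opp, Cmod_mult, Cmod_R.
    assert (Cmod (g n y - g n x)%C <= M n * Rabs (y - x)).
    { apply (increment_bound (g n) (g' n)); intros s Hs; [apply Hd | apply Hb];
        (apply Rabs_def2 in Hy1; apply Rabs_def1;
         revert Hs; unfold Rmin, Rmax; destruct (Rle_dec x y); lra). }
    pose proof (Hb n x Hxx); pose proof (Rabs_pos (y - x)).
    assert (Rabs (y - x) * Cmod (g' n x) <= Rabs (y - x) * M n)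
      by (apply Rmult_le_compat_l; lra).
    lra. }
  assert (Hrest : is_Cseries (fun n => h (S N + n)%nat)
            (G y - G x - RtoC (y - x) * l - sum_n h N)%C).
  { apply (is_series_incr_n (V := C_R_NormedModule)); [lia|]; simpl pred.
    refine (eq_ind _ (fun z => is_Cseries h z) Hh _ _).
    match goal with |- ?a = plus ?b _ =>
      change (a = Cplus b (sum_n (G := C_AbelianMonoid) h N)) end; ring. }
  assert (Hrest' : Cmod (G y - G x - RtoC (y - x) * l - sum_n h N)%C
            <= 2 * Rabs (y - x) * (Series M - sum_n M N)).
  { eapply is_Cseries_bound; [| | exact Hrest].
    - intros n; apply Hterm.
    - exact (is_series_scal_l (K := R_AbsRing) (2 * Rabs (y - x)) _ _ Htail). }
  assert (Hfin : Cmod (sum_n h N) <= eps / 2 * Rabs (y - x)).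
  { eapply Rle_trans; [| apply Hhead', Hy2]; right; f_equal.
    match goal with |- ?a = ?b => change (a = b :> C) end.
    unfold h; clear.
    induction N as [|N IH]; [rewrite !C_sum_O | rewrite !C_sum_Sn, IH]; cbv beta; ring. }
  replace (G y - G x - RtoC (y - x) * l)%C with
    ((G y - G x - RtoC (y - x) * l - sum_n h N) + sum_n h N)%C by ring.
  eapply Rle_trans; [apply Cmod_triangle|].
  pose proof (Rabs_pos (y - x)); nra.
Qed.

(** * Series of binomial sums *)

Definition converges_below (R0 : R) (c : nat -> C) : Prop :=
  forall r, 0 <= r < R0 -> Rbar_lt r (CV_radius (fun n => Cmod (c n))).

Definition shift_coeffs (c : nat -> C) (n : nat) : C :=
  (RtoC (INR (S n)) * c (S n))%C.

Lemma converges_below_shift (R0 : R) (c : nat -> C) :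
  converges_below R0 c -> converges_below R0 (shift_coeffs c).
Proof.
  intros H r Hr.
  rewrite (CV_radius_ext _ (PS_derive (fun n => Cmod (c n)))).
  - rewrite CV_radius_derive; apply H, Hr.
  - intros n; unfold shift_coeffs, PS_derive.
    rewrite Cmod_mult, Cmod_R, Rabs_pos_eq by apply pos_INR; reflexivity.
Qed.

Lemma converges_below_summable (R0 : R) (c : nat -> C) (r : R) :
  converges_below R0 c -> 0 <= r < R0 -> ex_series (fun n => Cmod (c n) * r ^ n).
Proof.
  intros H Hr.
  apply (ex_series_ext (fun n => Rabs (Cmod (c n) * r ^ n))).
  - intros n; apply Rabs_pos_eq, Rmult_le_pos; [apply Cmod_ge_0 | apply pow_le, Hr].
  - apply CV_disk_inside; rewrite (Rabs_pos_eq r) by apply Hr; apply H, Hr.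
Qed.

Lemma term_le_sum (u : nat -> R) (n N : nat) :
  (forall k, 0 <= u k) -> (n <= N)%nat -> u n <= sum_f_R0 u N.
Proof.
  intros Hu; induction N as [|N IH]; intros Hn.
  - replace n with O by lia; apply Rle_refl.
  - simpl sum_f_R0; pose proof (Hu (S N)).
    destruct (Nat.eq_dec n (S N)) as [-> | Hne].
    + pose proof (cond_pos_sum u N Hu); lra.
    + specialize (IH ltac:(lia)); lra.
Qed.

Lemma converges_below_of_bounded (R0 : R) (c : nat -> C) :
  (forall r, 0 <= r < R0 ->
     exists M N, forall n, (N <= n)%nat -> Cmod (c n) * r ^ n <= M) ->
  converges_below R0 c.
Proof.
  intros H r Hr.
  destruct (H ((r + R0) / 2)) as [M [N HM]]; [lra|].
  set (r' := (r + R0) / 2) in *.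
  assert (Hr' : 0 <= r') by (unfold r'; lra).
  apply Rbar_lt_le_trans with r'; [simpl; unfold r'; lra|].
  apply (proj1 (CV_radius_bounded (fun n => Cmod (c n)))).
  assert (Hpos : forall n, 0 <= Cmod (c n) * r' ^ n)
    by (intros n; apply Rmult_le_pos; [apply Cmod_ge_0 | apply pow_le, Hr']).
  exists (Rmax 0 M + sum_f_R0 (fun n => Cmod (c n) * r' ^ n) N).
  assert (Hs : forall m, 0 <= sum_f_R0 (fun n => Cmod (c n) * r' ^ n) m)
    by (intros m; apply cond_pos_sum; intros; apply Hpos).
  intros n; rewrite Rabs_pos_eq by apply Hpos.
  destruct (Nat.le_gt_cases N n) as [Hn | Hn].
  - specialize (HM n Hn); pose proof (Rmax_r 0 M); pose proof (Hs N); lra.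
  - pose proof (Rmax_l 0 M).
    pose proof (term_le_sum (fun n => Cmod (c n) * r' ^ n) n N Hpos ltac:(lia)).
    cbv beta in *; lra.
Qed.

(** The terms are differentiated into [c n * n * h (n-1)]; reindexing turns this
    into the series with the shifted coefficients. *)
Lemma Cderive_coeff_series (R0 : R) (c : nat -> C) (g h : nat -> R -> C)
    (w : R -> C) (G : R -> C) (x delta K r L : R) :
  converges_below R0 c -> 0 <= r < R0 -> 0 < delta ->
  (forall n y, Rabs (y - x) < delta ->
     Cderive (g n) y (RtoC (INR n) * h (pred n) y * w y)%C) ->
  (forall n y, Rabs (y - x) < delta -> Cmod (h n y) <= K * r ^ n) ->
  (forall y, Rabs (y - x) < delta -> Cmod (w y) <= L) ->
  (forall y, Rabs (y - x) < delta ->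
     is_Cseries (fun n => c n * g n y)%C (G y)) ->
  Cderive G x (Csum (fun n => shift_coeffs c n * h n x) * w x)%C.
Proof.
  intros Hc Hr Hdelta Hg Hh Hw HG.
  assert (Hxx : Rabs (x - x) < delta)
    by (rewrite Rminus_diag_eq, Rabs_R0 by reflexivity; exact Hdelta).
  assert (HK : 0 <= K).
  { pose proof (Hh O x Hxx) as H; rewrite pow_O in H.
    pose proof (Cmod_ge_0 (h O x)); lra. }
  assert (HL : 0 <= L) by (pose proof (Hw x Hxx); pose proof (Cmod_ge_0 (w x)); lra).
  pose proof (converges_below_summable _ _ r (converges_below_shift _ _ Hc) Hr) as HS.
  set (M := fun n => Cmod (c n) * INR n * (K * r ^ pred n) * L).
  apply (Cderive_series (fun n y => c n * g n y)%C
    (fun n y => c n * (RtoC (INR n) * h (pred n) y * w y))%C G _ M x delta);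
    try assumption.
  - intros n y Hy; apply Cderive_scal, Hg, Hy.
  - intros n y Hy; unfold M.
    rewrite !Cmod_mult, Cmod_R, Rabs_pos_eq by apply pos_INR.
    replace (Cmod (c n) * INR n * (K * r ^ pred n) * L)
      with (Cmod (c n) * (INR n * (K * r ^ pred n) * L)) by ring.
    apply Rmult_le_compat_l; [apply Cmod_ge_0|].
    apply Rmult_le_compat; [| apply Cmod_ge_0 | | apply Hw, Hy].
    + apply Rmult_le_pos; [apply pos_INR | apply Cmod_ge_0].
    + apply Rmult_le_compat_l; [apply pos_INR | apply Hh, Hy].
  - apply ex_series_incr_1.
    apply (ex_series_ext (fun n => scal (K * L) (Cmod (shift_coeffs c n) * r ^ n))).
    + intros n; unfold M, shift_coeffs; rewrite Cmod_mult, Cmod_R, Rabs_pos_eq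
        by apply pos_INR.
      change (K * L * (INR (S n) * Cmod (c (S n)) * r ^ n) =
              Cmod (c (S n)) * INR (S n) * (K * r ^ n) * L); ring.
    + apply (ex_series_scal_l (K := R_AbsRing) (V := R_NormedModule) (K * L)), HS.
  - apply is_Cseries_cons_0; [simpl INR; ring|].
    apply (is_Cseries_ext (fun n => w x * (shift_coeffs c n * h n x))%C).
    { intros n; unfold shift_coeffs; simpl pred; ring. }
    rewrite Cmult_comm; apply is_Cseries_scal.
    apply (is_Cseries_Csum _ (fun n => scal K (Cmod (shift_coeffs c n) * r ^ n))).
    + intros n; rewrite Cmod_mult.
      change (Cmod (shift_coeffs c n) * Cmod (h n x) <=
              K * (Cmod (shift_coeffs c n) * r ^ n)).
      replace (K * (Cmod (shift_coeffs c n) * r ^ n))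
        with (Cmod (shift_coeffs c n) * (K * r ^ n)) by ring.
      apply Rmult_le_compat_l; [apply Cmod_ge_0 | apply Hh, Hxx].
    + apply (ex_series_scal_l (K := R_AbsRing) (V := R_NormedModule) K), HS.
Qed.

(** The bound that makes the binomial sum of degree [n] at most
    [K (|x| + |t|)^n]; it is what a generating system satisfies by
    [gs_growth]. *)
Definition power_growth (b : R) (p : nat -> R -> C) : Prop :=
  forall r, r < b -> exists K, 0 <= K /\
    forall k x, Rabs x <= r -> Cmod (p k x) <= K * Rabs x ^ k.

Definition appell_series (c : nat -> C) (p : nat -> R -> C) (x t : R) : C :=
  Csum (fun n => c n * appell p n x t)%C.

Lemma appell_term_bound b p r :
  power_growth b p -> 0 <= r < b -> exists K, 0 <= K /\
    forall n x t, Rabs x <= r -> Rabs t <= r ->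
      Cmod (appell p n x t) <= K * (2 * r) ^ n.
Proof.
  intros Hp Hr; destruct (Hp r (proj2 Hr)) as [K [HK Hb]].
  exists K; split; [exact HK|]; intros n x t Hx Ht.
  eapply Rle_trans; [apply (appell_bound p K); intros k; apply Hb, Hx|].
  apply Rmult_le_compat_l; [exact HK|].
  apply pow_incr; pose proof (Rabs_pos x); pose proof (Rabs_pos t); lra.
Qed.

Lemma interior_radius b x t :
  - b < x < b -> - b < t < b ->
  exists r delta, 0 <= r < b /\ 0 < delta /\
    (forall y, Rabs (y - x) < delta -> Rabs y <= r) /\
    (forall s, Rabs (s - t) < delta -> Rabs s <= r).
Proof.
  intros Hx Ht.
  set (m := Rmax (Rabs x) (Rabs t)).
  assert (Hm : m < b) by (apply Rmax_lub_lt; apply Rabs_def1; lra).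
  assert (Hxm : Rabs x <= m) by apply Rmax_l.
  assert (Htm : Rabs t <= m) by apply Rmax_r.
  pose proof (Rabs_pos x).
  exists ((m + b) / 2), ((b - m) / 2); repeat split; try lra.
  - intros y Hy; replace y with (x + (y - x)) by ring.
    eapply Rle_trans; [apply Rabs_triang|]; lra.
  - intros s Hs; replace s with (t + (s - t)) by ring.
    eapply Rle_trans; [apply Rabs_triang|]; lra.
Qed.

Lemma center_close (x delta : R) : 0 < delta -> Rabs (x - x) < delta.
Proof. intros H; rewrite Rminus_diag_eq, Rabs_R0 by reflexivity; exact H. Qed.

Lemma appell_series_correct b c p x t :
  converges_below (2 * b) c -> power_growth b p ->
  - b < x < b -> - b < t < b ->
  is_Cseries (fun n => c n * appell p n x t)%C (appell_series c p x t).
Proof.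
  intros Hc Hp Hx Ht.
  destruct (interior_radius b x t Hx Ht) as [r [delta [Hr [Hdelta [Hxr Htr]]]]].
  destruct (appell_term_bound b p r Hp Hr) as [K [HK Hb]].
  apply (is_Cseries_Csum _ (fun n => scal K (Cmod (c n) * (2 * r) ^ n))).
  - intros n; rewrite Cmod_mult.
    change (Cmod (c n) * Cmod (appell p n x t) <= K * (Cmod (c n) * (2 * r) ^ n)).
    replace (K * (Cmod (c n) * (2 * r) ^ n))
      with (Cmod (c n) * (K * (2 * r) ^ n)) by ring.
    apply Rmult_le_compat_l; [apply Cmod_ge_0|].
    apply Hb; [apply Hxr | apply Htr]; apply center_close, Hdelta.
  - apply (ex_series_scal_l (K := R_AbsRing) (V := R_NormedModule) K).
    apply (converges_below_summable (2 * b)); [exact Hc | lra].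
Qed.

Lemma appell_series_derive_t b c p x t :
  converges_below (2 * b) c -> power_growth b p ->
  - b < x < b -> - b < t < b ->
  Cderive (fun s => appell_series c p x s) t
    (appell_series (shift_coeffs c) p x t).
Proof.
  intros Hc Hp Hx Ht.
  destruct (interior_radius b x t Hx Ht) as [r [delta [Hr [Hdelta [Hxr Htr]]]]].
  destruct (appell_term_bound b p r Hp Hr) as [K [HK Hb]].
  assert (Hxx := Hxr x (center_close x delta Hdelta)).
  eapply Cderive_eq.
  - apply (Cderive_coeff_series (2 * b) c (fun n s => appell p n x s)
      (fun n s => appell p n x s) (fun _ => RtoC 1) _ t delta K (2 * r) 1);
      [exact Hc | lra | exact Hdelta | | | |].
    + intros n s Hs; eapply Cderive_eq; [apply appell_derive_t | ring].
    + intros n s Hs; apply Hb; [exact Hxx | apply Htr, Hs].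
    + intros s Hs; rewrite Cmod_1; lra.
    + intros s Hs; apply (appell_series_correct b); try assumption.
      specialize (Htr s Hs); apply Rabs_le_between in Htr; lra.
  - unfold appell_series; ring.
Qed.

Lemma appell_series_derive_x b c p q w x t :
  converges_below (2 * b) c -> power_growth b p -> power_growth b q ->
  locally_bounded b w ->
  (forall k y, - b < y < b ->
     Cderive (p k) y (RtoC (INR k) * q (pred k) y * w y)%C) ->
  - b < x < b -> - b < t < b ->
  Cderive (fun y => appell_series c p y t) x
    (appell_series (shift_coeffs c) q x t * w x)%C.
Proof.
  intros Hc Hp Hq Hw Hpq Hx Ht.
  destruct (interior_radius b x t Hx Ht) as [r [delta [Hr [Hdelta [Hxr Htr]]]]].
  destruct (appell_term_bound b q r Hq Hr) as [K [HK Hb]].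
  destruct (Hw r (proj2 Hr)) as [L HL].
  assert (Htt := Htr t (center_close t delta Hdelta)).
  assert (Hin : forall y, Rabs (y - x) < delta -> - b < y < b)
    by (intros y Hy; specialize (Hxr y Hy); apply Rabs_le_between in Hxr; lra).
  apply (Cderive_coeff_series (2 * b) c (fun n y => appell p n y t)
    (fun n y => appell q n y t) w _ x delta K (2 * r) L);
    [exact Hc | lra | exact Hdelta | | | |].
  - intros n y Hy; apply appell_derive_x; intros k; apply Hpq, Hin, Hy.
  - intros n y Hy; apply Hb; [apply Hxr, Hy | exact Htt].
  - intros y Hy; apply HL, Hxr, Hy.
  - intros y Hy; apply (appell_series_correct b); try assumption; apply Hin, Hy.
Qed.

Lemma appell_series_origin c p :
  p O 0 = RtoC 1 -> (forall k, p (S k) 0 = RtoC 0) ->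
  appell_series c p 0 0 = c O.
Proof.
  intros H0 HS.
  assert (H : is_Cseries (fun n => c n * appell p n 0 0)%C (c O)).
  { apply is_Cseries_eps; intros eps Heps; exists O; intros n _.
    replace (sum_n (fun n => c n * appell p n 0 0)%C n - c O)%C with (RtoC 0);
      [rewrite Cmod_0; exact Heps|].
    induction n as [|n IH].
    - rewrite C_sum_O, appell_O, H0; ring.
    - rewrite C_sum_Sn, (appell_origin p n HS).
      rewrite IH at 1; ring. }
  apply (is_Cseries_unique (fun n => c n * appell p n 0 0)%C); [| exact H].
  apply (is_Cseries_Csum _ (fun n => scal (Cmod (c O)) (0 ^ n))).
  - intros [|n]; change (scal ?u ?v) with (u * v).
    + rewrite appell_O, H0, Cmult_1_r, pow_O, Rmult_1_r; apply Rle_refl.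
    + rewrite (appell_origin p n HS), Cmult_0_r, Cmod_0, pow_i, Rmult_0_r by lia.
      apply Rle_refl.
  - apply (ex_series_scal_l (K := R_AbsRing) (V := R_NormedModule)), ex_series_geom.
    rewrite Rabs_R0; lra.
Qed.

Lemma gs_power_growth b f f1 f2 A B :
  generating_system b f f1 f2 A B -> power_growth b A.
Proof.
  intros G r Hr.
  destruct (gs_growth _ _ _ _ _ _ _ G Hr) as [K [HK Hb]].
  destruct (locally_bounded_nonneg _ _ _ (gs_inverse_locally_bounded _ _ _ _ _ _ G) Hr)
    as [m [Hm0 Hm]].
  exists (m * K); split; [nra|]; intros k x Hx.
  replace (A k x) with (/ f x * (f x * A k x))%C.
  - rewrite Cmod_mult, Rmult_assoc.
    apply Rmult_le_compat; try apply Cmod_ge_0; [apply Hm | apply Hb]; exact Hx.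
  - field; eapply gs_neq_0; [eassumption|].
    apply Rabs_le_between in Hx; lra.
Qed.

(** * Growth of the coefficients *)

(** The coordinates of [a] on the idempotents [(1 + j)/2] and [(1 - j)/2], which
    carry the powers of [x + t] and of [x - t]. *)
Definition plus_part (a : nat -> Bicomplex) (n : nat) : C := (fst (a n) + snd (a n))%C.
Definition minus_part (a : nat -> Bicomplex) (n : nat) : C := (fst (a n) - snd (a n))%C.

Lemma wave_pol_odd p m x t :
  wave_pol p (2 * S m - 1) x t = binom_sum Nat.even p (S m) x t.
Proof.
  replace (2 * S m - 1)%nat with (S (2 * m)) by lia.
  unfold wave_pol; rewrite Nat.odd_succ, Nat.even_even.
  replace (S (S (2 * m))) with (2 * S m)%nat by lia.
  rewrite Nat.div2_double; reflexivity.
Qed.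

Lemma wave_pol_even p m x t :
  wave_pol p (2 * S m) x t = binom_sum Nat.odd p (S m) x t.
Proof.
  replace (wave_pol p (2 * S m)) with
    (fun x t => if Nat.odd (2 * S m) then binom_sum Nat.even p (Nat.div2 (S (2 * S m))) x t
                else binom_sum Nat.odd p (Nat.div2 (2 * S m)) x t)
    by (simpl Nat.mul; reflexivity).
  rewrite Nat.odd_even, Nat.div2_double; reflexivity.
Qed.

Lemma RtoC_2_neq_0 : RtoC 2 <> RtoC 0.
Proof. intros E; apply (f_equal fst) in E; simpl in E; lra. Qed.

Lemma formal_power_split f a n x t :
  formal_power f n (a n) x t =
  ((RtoC (/ 2) * (plus_part a n * appell (phi_ f) n x t
                  + minus_part a n * appell (phi_ f) n x (- t)))%C,
   (RtoC (/ 2) * (plus_part a n * appell (psi_ f) n x t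
                  - minus_part a n * appell (psi_ f) n x (- t)))%C).
Proof.
  pose proof RtoC_2_neq_0.
  unfold plus_part, minus_part; destruct n as [|n].
  - unfold formal_power, u_, v_, wave_pol, Bplus, Bmult, BC, Bj; simpl fst; simpl snd.
    rewrite !appell_O, RtoC_inv by lra; f_equal; field; assumption.
  - unfold formal_power, u_, v_.
    rewrite !wave_pol_odd, !wave_pol_even, !binom_sum_even, !binom_sum_odd.
    unfold Bplus, Bmult, BC, Bj; simpl fst; simpl snd.
    rewrite RtoC_inv by lra; f_equal; field; assumption.
Qed.

Lemma Bmod_fst (w : Bicomplex) : Cmod (fst w) <= Bmod w.
Proof.
  unfold Bmod.
  replace (Cmod (fst w)) with (/ 2 * Cmod ((fst w + snd w) + (fst w - snd w))%C).
  - pose proof (Cmod_triangle (fst w + snd w) (fst w - snd w)); lra.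
  - replace ((fst w + snd w) + (fst w - snd w))%C with (RtoC 2 * fst w)%C by ring.
    rewrite Cmod_mult, Cmod_R, Rabs_pos_eq by lra; lra.
Qed.

Lemma Bmod_snd (w : Bicomplex) : Cmod (snd w) <= Bmod w.
Proof.
  unfold Bmod.
  replace (Cmod (snd w)) with (/ 2 * Cmod ((fst w + snd w) + - (fst w - snd w))%C).
  - pose proof (Cmod_triangle (fst w + snd w) (- (fst w - snd w))).
    rewrite Cmod_opp in *; lra.
  - replace ((fst w + snd w) + - (fst w - snd w))%C with (RtoC 2 * snd w)%C by ring.
    rewrite Cmod_mult, Cmod_R, Rabs_pos_eq by lra; lra.
Qed.

Lemma B_partial_sum_components w N :
  B_partial_sum w N = (sum_n (fun n => fst (w n)) N, sum_n (fun n => snd (w n)) N).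
Proof.
  induction N as [|N IH]; simpl B_partial_sum.
  - rewrite !C_sum_O; apply surjective_pairing.
  - rewrite IH, !C_sum_Sn; reflexivity.
Qed.

Lemma uniform_expansion_components b f a W x t :
  uniform_expansion b f a W -> closed_square b x t ->
  is_Cseries (fun n => fst (formal_power f n (a n) x t)) (fst (W x t)) /\
  is_Cseries (fun n => snd (formal_power f n (a n) x t)) (snd (W x t)).
Proof.
  intros HW Hxt; split; apply is_Cseries_eps; intros eps Heps;
    destruct (HW eps Heps) as [N HN]; exists N; intros n Hn;
    specialize (HN n Hn x t Hxt); rewrite B_partial_sum_components in HN.
  - rewrite <- Cmod_opp; eapply Rle_lt_trans; [| exact HN].
    eapply Rle_trans; [| apply Bmod_fst]; right; f_equal; simpl; ring.
  - rewrite <- Cmod_opp; eapply Rle_lt_trans; [| exact HN].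
    eapply Rle_trans; [| apply Bmod_snd]; right; f_equal; simpl; ring.
Qed.

Lemma uniform_expansion_terms_bounded b f a W :
  uniform_expansion b f a W ->
  exists N, forall n, (N <= n)%nat -> forall x t, closed_square b x t ->
    Bmod (formal_power f n (a n) x t) <= 2.
Proof.
  intros HW; destruct (HW 1 Rlt_0_1) as [N HN].
  exists (S N); intros n Hn x t Hxt.
  destruct n as [|n]; [lia|].
  pose proof (HN n ltac:(lia) x t Hxt) as H1.
  pose proof (HN (S n) ltac:(lia) x t Hxt) as H2.
  change (B_partial_sum ?u (S n)) with (Bplus (B_partial_sum u n) (u (S n))) in H2.
  cbv beta in H2.
  set (P := B_partial_sum _ n) in *.
  set (z := formal_power f (S n) (a (S n)) x t) in *; clearbody P z.
  unfold Bmod, Bminus, Bplus in *; simpl fst in *; simpl snd in *.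
  set (w := W x t) in *.
  pose proof (Cmod_triangle ((fst w - fst P) + (snd w - snd P))
    (- ((fst w - (fst P + fst z)) + (snd w - (snd P + snd z))))) as T1.
  pose proof (Cmod_triangle ((fst w - fst P) - (snd w - snd P))
    (- ((fst w - (fst P + fst z)) - (snd w - (snd P + snd z))))) as T2.
  rewrite Cmod_opp in T1, T2.
  match type of T1 with Cmod ?u <= _ =>
    replace u with (fst z + snd z)%C in T1 by ring end.
  match type of T2 with Cmod ?u <= _ =>
    replace u with (fst z - snd z)%C in T2 by ring end.
  lra.
Qed.

(** If [p] and [q] are the values at the corner of the square of the two
    functions attached to the terms of degree [n], close to [P], and [p'], [q']
    their values at the opposite corner, close to [0], then the bound on the
    term bounds the coefficients. *)
Lemma corner_bound (cp cm p q p' q' : C) (P E : R) :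
  0 <= P -> 0 <= E ->
  Cmod (p - RtoC P)%C <= E -> Cmod (q - RtoC P)%C <= E ->
  Cmod p' <= E -> Cmod q' <= E ->
  Cmod (RtoC (/ 2) * (cp * (p + q) + cm * (p' - q')))%C <= 4 ->
  Cmod cp * P <= 4 + E * (Cmod cp + Cmod cm).
Proof.
  intros HP HE Hp Hq Hp' Hq' H.
  pose proof (Cmod_ge_0 cp); pose proof (Cmod_ge_0 cm).
  replace (Cmod cp * P) with (Cmod (cp * RtoC P)%C)
    by (rewrite Cmod_mult, Cmod_R, Rabs_pos_eq by exact HP; reflexivity).
  replace (cp * RtoC P)%C with
    (RtoC (/ 2) * (cp * (p + q) + cm * (p' - q'))
     + - (RtoC (/ 2) * (cp * ((p - RtoC P) + (q - RtoC P))
                        + cm * (p' + - q'))))%C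
    by (rewrite RtoC_inv by lra; field; apply RtoC_2_neq_0).
  eapply Rle_trans; [apply Cmod_triangle|]; rewrite Cmod_opp.
  apply Rplus_le_compat; [exact H|].
  rewrite Cmod_mult, Cmod_R, Rabs_pos_eq by lra.
  eapply Rle_trans; [apply Rmult_le_compat_l, Cmod_triangle; lra|].
  rewrite !Cmod_mult.
  pose proof (Cmod_triangle (p - RtoC P) (q - RtoC P)) as T1.
  pose proof (Cmod_triangle p' (- q')) as T2; rewrite Cmod_opp in T2.
  assert (Cmod cp * Cmod (p - RtoC P + (q - RtoC P))%C <= Cmod cp * (2 * E))
    by (apply Rmult_le_compat_l; lra).
  assert (Cmod cm * Cmod (p' + - q')%C <= Cmod cm * (2 * E))
    by (apply Rmult_le_compat_l; lra).
  lra.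
Qed.

(** At [(r, r)] the term of degree [n] is nearly [(2r)^n] times the coefficient on
    [(1 + j)/2], and at [(r, -r)] nearly [(2r)^n] times the one on [(1 - j)/2].  In
    each estimate the other coefficient enters with a factor [O(1/n)], so adding
    the two absorbs the errors once [n] is large. *)
Lemma expansion_coefficients_bounded b f df ddf a W r :
  generating_system b f df ddf (A_pow f) (B_pow f) ->
  uniform_expansion b f a W -> 0 <= r < b ->
  exists N, forall n, (N <= n)%nat ->
    (Cmod (plus_part a n) + Cmod (minus_part a n)) * (2 * r) ^ n <= 16.
Proof.
  intros G HW Hr.
  destruct (gs_asymptotics _ _ _ _ _ _ _ G (proj2 Hr)) as [D1 [HD1 Hphi]].
  destruct (gs_asymptotics _ _ _ _ _ _ _ (generating_system_dual _ _ _ _ _ _ G)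
              (proj2 Hr)) as [D2 [HD2 Hpsi]].
  set (D := D1 + D2).
  destruct (uniform_expansion_terms_bounded _ _ _ _ HW) as [N HN].
  (* For [n + 1 >= 8 D] the relative error [2 D / (n + 1)] is at most [1/4]. *)
  destruct (nfloor_ex (8 * D)) as [N' HN']; [unfold D; lra|].
  exists (S (Nat.max N N')); intros n Hn.
  specialize (HN n ltac:(lia)).
  destruct n as [|m]; [lia|]; set (n := S m) in *.
  assert (Hpos : 0 < INR (S n)) by (apply lt_0_INR; lia).
  set (P := (2 * r) ^ n); set (E := 2 * D * P / INR (S n)).
  assert (HP : 0 <= P) by (apply pow_le; lra).
  assert (HE : 0 <= E)
    by (apply Rmult_le_pos; [unfold D; nra | left; apply Rinv_0_lt_compat, Hpos]).
  assert (Hr' : Rabs r <= r) by (rewrite Rabs_pos_eq; lra).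
  assert (Hmr : Rabs (- r) <= r) by (rewrite Rabs_Ropp; exact Hr').
  assert (HD : forall Di, 0 <= Di -> Di <= D -> 2 * Di * (2 * r) ^ n / INR (S n) <= E).
  { intros Di H0 HDi; unfold E, Rdiv.
    apply Rmult_le_compat_r; [left; apply Rinv_0_lt_compat, Hpos|].
    apply Rmult_le_compat_r; [exact HP | lra]. }
  assert (Sphi : forall s, Rabs s <= r ->
            Cmod (appell (phi_ f) n r s - RtoC ((r + s) ^ n))%C <= E).
  { intros s Hs; eapply Rle_trans; [apply (appell_asymptotics _ D1 r); try assumption|].
    - intros k; rewrite phi_A_pow; apply Hphi, Hr'.
    - apply HD; [exact HD1 | unfold D; lra]. }
  assert (Spsi : forall s, Rabs s <= r ->
            Cmod (appell (psi_ f) n r s - RtoC ((r + s) ^ n))%C <= E).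
  { intros s Hs; eapply Rle_trans; [apply (appell_asymptotics _ D2 r); try assumption|].
    - intros k; rewrite psi_B_pow; apply Hpsi, Hr'.
    - apply HD; [exact HD2 | unfold D; lra]. }
  assert (Hzero : (r + - r) ^ n = 0)
    by (rewrite Rplus_opp_r; unfold n; apply pow_i; lia).
  pose proof (Sphi r Hr') as P1; pose proof (Spsi r Hr') as Q1.
  pose proof (Sphi (- r) Hmr) as P2; pose proof (Spsi (- r) Hmr) as Q2.
  rewrite Hzero in P2, Q2.
  replace (r + r) with (2 * r) in P1, Q1 by ring; fold P in P1, Q1.
  replace (appell (phi_ f) n r (- r) - RtoC 0)%C with (appell (phi_ f) n r (- r)) in P2 by ring.
  replace (appell (psi_ f) n r (- r) - RtoC 0)%C with (appell (psi_ f) n r (- r)) in Q2 by ring.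
  pose proof (HN r r ltac:(unfold closed_square, segment; lra)) as H1.
  pose proof (HN r (- r) ltac:(unfold closed_square, segment; lra)) as H2.
  rewrite formal_power_split in H1, H2; rewrite Ropp_involutive in H2.
  unfold Bmod in H1, H2; simpl fst in H1, H2; simpl snd in H1, H2.
  set (cp := plus_part a n) in *; set (cm := minus_part a n) in *.
  set (p := appell (phi_ f) n r r) in *; set (q := appell (psi_ f) n r r) in *.
  set (p' := appell (phi_ f) n r (- r)) in *; set (q' := appell (psi_ f) n r (- r)) in *.
  assert (Bp : Cmod cp * P <= 4 + E * (Cmod cp + Cmod cm)).
  { apply (corner_bound cp cm p q p' q'); try assumption.
    match type of H1 with / 2 * (Cmod ?u + Cmod ?v) <= 2 =>
      pose proof (Cmod_ge_0 v);
      replace (RtoC (/ 2) * (cp * (p + q) + cm * (p' - q')))%C with u by ring end.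
    lra. }
  assert (Bm : Cmod cm * P <= 4 + E * (Cmod cm + Cmod cp)).
  { apply (corner_bound cm cp p q p' q'); try assumption.
    match type of H2 with / 2 * (Cmod ?u + Cmod ?v) <= 2 =>
      pose proof (Cmod_ge_0 u);
      replace (RtoC (/ 2) * (cm * (p + q) + cp * (p' - q')))%C with v by ring end.
    lra. }
  assert (HE4 : E <= P / 4).
  { unfold E; apply Rmult_le_reg_r with (INR (S n)); [exact Hpos|].
    replace (2 * D * P / INR (S n) * INR (S n)) with (P / 4 * (8 * D)) by (field; lra).
    apply Rmult_le_compat_l; [lra|].
    assert (INR N' <= INR n) by (apply le_INR; lia).
    rewrite S_INR; lra. }
  pose proof (Cmod_ge_0 cp); pose proof (Cmod_ge_0 cm).
  assert (E * (Cmod cp + Cmod cm) <= P / 4 * (Cmod cp + Cmod cm))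
    by (apply Rmult_le_compat_r; lra).
  lra.
Qed.

Lemma expansion_coefficients_converge b f df ddf a W :
  generating_system b f df ddf (A_pow f) (B_pow f) ->
  uniform_expansion b f a W ->
  converges_below (2 * b) (plus_part a) /\ converges_below (2 * b) (minus_part a).
Proof.
  intros G HW; split; apply converges_below_of_bounded; intros r Hr;
    (destruct (expansion_coefficients_bounded _ _ _ _ _ _ (r / 2) G HW ltac:(lra))
      as [N HN]; exists 16, N; intros n Hn; specialize (HN n Hn);
    replace (2 * (r / 2)) with r in HN by field;
    pose proof (Cmod_ge_0 (plus_part a n)); pose proof (Cmod_ge_0 (minus_part a n));
    pose proof (pow_le r n (proj1 Hr)); nra).
Qed.

(** * Bers derivatives of the series *)

(** The scalar and the [j] part of a bicomplex series, with [c] and [d] the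
    coefficients on the two idempotents. *)
Definition sym_series (c d : nat -> C) (p : nat -> R -> C) (x t : R) : C :=
  (RtoC (/ 2) * (appell_series c p x t + appell_series d p x (- t)))%C.
Definition antisym_series (c d : nat -> C) (p : nat -> R -> C) (x t : R) : C :=
  (RtoC (/ 2) * (appell_series c p x t - appell_series d p x (- t)))%C.

Lemma Cderive_reflect (g : R -> C) (t : R) (l : C) :
  Cderive g (- t) l -> Cderive (fun s => g (- s)) t (- l)%C.
Proof.
  intros H; eapply Cderive_eq.
  - apply (Cderive_comp g (fun s => - s) t (- (1))); [exact H|].
    auto_derive; [exact I | ring].
  - rewrite RtoC_opp; ring.
Qed.

Lemma sym_series_partials b c d p q w :
  converges_below (2 * b) c -> converges_below (2 * b) d ->
  power_growth b p -> power_growth b q -> locally_bounded b w ->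
  (forall k y, - b < y < b ->
     Cderive (p k) y (RtoC (INR k) * q (pred k) y * w y)%C) ->
  has_partials C_R_NormedModule b (sym_series c d p)
    (fun x t => sym_series (shift_coeffs c) (shift_coeffs d) q x t * w x)%C
    (antisym_series (shift_coeffs c) (shift_coeffs d) p).
Proof.
  intros Hc Hd Hp Hq Hw Hpq x t [Hx Ht].
  assert (Ht' : - b < - t < b) by lra.
  split; unfold sym_series, antisym_series.
  - eapply Cderive_eq.
    + apply Cderive_scal, Cderive_plus;
        apply (appell_series_derive_x b _ p q w); assumption.
    + ring.
  - apply Cderive_scal, Cderive_plus.
    + apply (appell_series_derive_t b); assumption.
    + apply (Cderive_reflect (fun s => appell_series d p x s)).
      apply (appell_series_derive_t b); assumption.
Qed.

Lemma antisym_series_partials b c d p q w :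
  converges_below (2 * b) c -> converges_below (2 * b) d ->
  power_growth b p -> power_growth b q -> locally_bounded b w ->
  (forall k y, - b < y < b ->
     Cderive (p k) y (RtoC (INR k) * q (pred k) y * w y)%C) ->
  has_partials C_R_NormedModule b (antisym_series c d p)
    (fun x t => antisym_series (shift_coeffs c) (shift_coeffs d) q x t * w x)%C
    (sym_series (shift_coeffs c) (shift_coeffs d) p).
Proof.
  intros Hc Hd Hp Hq Hw Hpq x t [Hx Ht].
  assert (Ht' : - b < - t < b) by lra.
  split; unfold sym_series, antisym_series.
  - eapply Cderive_eq.
    + apply Cderive_scal, Cderive_minus;
        apply (appell_series_derive_x b _ p q w); assumption.
    + ring.
  - eapply Cderive_eq.
    + apply Cderive_scal, Cderive_minus.
      * apply (appell_series_derive_t b); assumption.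
      * apply (Cderive_reflect (fun s => appell_series d p x s)).
        apply (appell_series_derive_t b); assumption.
    + ring.
Qed.

(** The function whose coefficients in the [n]-th generating pair are the two
    series; the pairs alternate between [f] and [1/f], hence so do [A] and [B]. *)
Definition bers_series (f : R -> C) (A B : nat -> R -> C) (c d : nat -> C)
    (n : nat) (x t : R) : Bicomplex :=
  let p := if Nat.even n then A else B in
  let q := if Nat.even n then B else A in
  (BC (sym_series c d p x t) * gen_F f n x
   + BC (antisym_series c d q x t) * gen_G f n x)%B.

(** Both partial derivatives of the two coefficients are again of the same form,
    with [A] and [B] exchanged in [x]; the Vekua equation, which identifies the
    [x]-derivative of one with the [t]-derivative of the other up to the weight
    [f^2], is thereby built into the series. *)
Lemma bers_series_step b f f1 f2 A B c d n :
  generating_system b f f1 f2 A B ->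
  converges_below (2 * b) c -> converges_below (2 * b) d ->
  is_Bers_step b f n (bers_series f A B c d n)
    (bers_series f A B (shift_coeffs c) (shift_coeffs d) (S n)).
Proof.
  intros G Hc Hd.
  pose proof (generating_system_dual _ _ _ _ _ _ G) as G'.
  pose proof (gs_power_growth _ _ _ _ _ _ G) as HA.
  pose proof (gs_power_growth _ _ _ _ _ _ G') as HB.
  pose proof (gs_inverse_locally_bounded _ _ _ _ _ _ G) as Hi.
  assert (Hf : locally_bounded b f).
  { apply continuous_locally_bounded; intros x Hx.
    eapply Cderive_continuous, gs_derive; eassumption. }
  assert (Hw : locally_bounded b (fun x => / f x * / f x)%C)
    by (apply locally_bounded_mult; exact Hi).
  assert (Hv : locally_bounded b (fun x => f x * f x)%C)
    by (apply locally_bounded_mult; exact Hf).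
  assert (HAB : forall k y, - b < y < b ->
    Cderive (A k) y (RtoC (INR k) * B (pred k) y * (/ f y * / f y))%C).
  { intros k y Hy; eapply Cderive_eq; [eapply gs_derive_A; eassumption|].
    field; eapply gs_neq_0; eassumption. }
  assert (HBA : forall k y, - b < y < b ->
    Cderive (B k) y (RtoC (INR k) * A (pred k) y * (f y * f y))%C)
    by (intros k y Hy; eapply gs_derive_B; eassumption).
  pose proof RtoC_2_neq_0 as H2.
  unfold is_Bers_step, bers_series, gen_F, gen_G.
  rewrite Nat.even_succ, <- Nat.negb_even.
  destruct (Nat.even n); simpl negb; cbv iota zeta.
  - exists (sym_series c d A), (antisym_series c d B). do 4 eexists.
    split; [reflexivity | split; [| split]].
    + apply (sym_series_partials b c d A B (fun x => / f x * / f x)%C); assumption.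
    + apply (antisym_series_partials b c d B A (fun x => f x * f x)%C); assumption.
    + intros x t [Hx _]; pose proof (gs_neq_0 _ _ _ _ _ _ G x Hx) as Hn.
      unfold d_z, BC, Bj, Bplus, Bmult; simpl fst; simpl snd.
      rewrite RtoC_inv by lra; f_equal; field; repeat split; assumption.
  - exists (sym_series c d B), (antisym_series c d A). do 4 eexists.
    split; [reflexivity | split; [| split]].
    + apply (sym_series_partials b c d B A (fun x => f x * f x)%C); assumption.
    + apply (antisym_series_partials b c d A B (fun x => / f x * / f x)%C); assumption.
    + intros x t [Hx _]; pose proof (gs_neq_0 _ _ _ _ _ _ G x Hx) as Hn.
      unfold d_z, BC, Bj, Bplus, Bmult; simpl fst; simpl snd.
      rewrite RtoC_inv by lra; f_equal; field; repeat split; assumption.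
Qed.

Lemma bers_series_origin b f f1 f2 A B c d n :
  generating_system b f f1 f2 A B ->
  bers_series f A B c d n 0 0
  = ((RtoC (/ 2) * (c O + d O))%C, (RtoC (/ 2) * (c O - d O))%C).
Proof.
  intros G.
  assert (OA : forall e, appell_series e A 0 0 = e O)
    by (intros e; apply appell_series_origin;
        [apply (gs_A_0 _ _ _ _ _ _ G) | apply (gs_A_at_0 _ _ _ _ _ _ G)]).
  assert (OB : forall e, appell_series e B 0 0 = e O)
    by (intros e; apply appell_series_origin;
        [apply (gs_B_0 _ _ _ _ _ _ G) | apply (gs_B_at_0 _ _ _ _ _ _ G)]).
  unfold bers_series, gen_F, gen_G, sym_series, antisym_series.
  destruct (Nat.even n); cbv iota zeta;
    rewrite Ropp_0, !OA, !OB, (gs_at_0 _ _ _ _ _ _ G);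
    unfold BC, Bj, Bplus, Bmult; simpl fst; simpl snd;
    apply f_equal2; field.
Qed.

Lemma converges_below_iter_shift R0 c n :
  converges_below R0 c -> converges_below R0 (Nat.iter n shift_coeffs c).
Proof.
  intros H; induction n as [|n IH]; [exact H | apply converges_below_shift, IH].
Qed.

Lemma iter_shift_coeffs c n m :
  (RtoC (INR (fact m)) * Nat.iter n shift_coeffs c m
   = RtoC (INR (fact (m + n))) * c (m + n)%nat)%C.
Proof.
  revert m; induction n as [|n IH]; intros m.
  - rewrite Nat.add_0_r; reflexivity.
  - change (Nat.iter (S n) shift_coeffs c m)
      with (RtoC (INR (S m)) * Nat.iter n shift_coeffs c (S m))%C.
    rewrite Cmult_assoc, <- RtoC_mult, <- mult_INR, Nat.mul_comm.
    change (S m * fact m)%nat with (fact (S m)).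
    rewrite IH; replace (S m + n)%nat with (m + S n)%nat by lia; reflexivity.
Qed.

Lemma iter_shift_coeffs_0 c n :
  Nat.iter n shift_coeffs c O = (RtoC (INR (fact n)) * c n)%C.
Proof.
  pose proof (iter_shift_coeffs c n 0) as H; simpl in H.
  rewrite Cmult_1_l in H; exact H.
Qed.

(** Uniform convergence is used here only pointwise: the partial sums tend to [W]
    and to the rearranged series. *)
Lemma expansion_is_bers_series b f df ddf W a x t :
  generating_system b f df ddf (A_pow f) (B_pow f) ->
  uniform_expansion b f a W -> open_square b x t ->
  bers_series f (A_pow f) (B_pow f) (plus_part a) (minus_part a) 0 x t = W x t.
Proof.
  intros G HW [Hx Ht].
  destruct (expansion_coefficients_converge _ _ _ _ _ _ G HW) as [Hc Hd].
  pose proof (gs_power_growth _ _ _ _ _ _ G) as HA.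
  pose proof (gs_power_growth _ _ _ _ _ _ (generating_system_dual _ _ _ _ _ _ G)) as HB.
  assert (Ht' : - b < - t < b) by lra.
  destruct (uniform_expansion_components b f a W x t HW) as [H1 H2];
    [unfold closed_square, segment; lra|].
  unfold bers_series, gen_F, gen_G; simpl Nat.even; cbv iota zeta.
  rewrite (surjective_pairing (W x t)).
  unfold BC, Bj, Bplus, Bmult; simpl fst; simpl snd; f_equal.
  - assert (S : is_Cseries (fun n => fst (formal_power f n (a n) x t))
      (f x * RtoC (/ 2) * appell_series (plus_part a) (A_pow f) x t
       + f x * RtoC (/ 2) * appell_series (minus_part a) (A_pow f) x (- t))%C).
    { eapply is_Cseries_ext;
        [| exact (is_Cseries_lincomb _ _ _ _ _ _
                    (appell_series_correct b _ _ x t Hc HA Hx Ht)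
                    (appell_series_correct b _ _ x (- t) Hd HA Hx Ht'))].
      intros n; rewrite formal_power_split; simpl fst.
      rewrite !(appell_factor _ _ (f x) n x _ (fun k => phi_A_pow f k x)); ring. }
    rewrite (is_Cseries_unique _ _ _ H1 S); unfold sym_series; ring.
  - assert (S : is_Cseries (fun n => snd (formal_power f n (a n) x t))
      (/ f x * RtoC (/ 2) * appell_series (plus_part a) (B_pow f) x t
       + - (/ f x * RtoC (/ 2)) * appell_series (minus_part a) (B_pow f) x (- t))%C).
    { eapply is_Cseries_ext;
        [| exact (is_Cseries_lincomb _ _ _ _ _ _
                    (appell_series_correct b _ _ x t Hc HB Hx Ht)
                    (appell_series_correct b _ _ x (- t) Hd HB Hx Ht'))].
      intros n; rewrite formal_power_split; simpl snd.
      rewrite !(appell_factor _ _ (/ f x) n x _ (fun k => psi_B_pow f k x)); ring. }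
    rewrite (is_Cseries_unique _ _ _ H2 S); unfold antisym_series; ring.
Qed.

Theorem theorem6p2 :
  forall (b : R) (f df ddf : R -> C) (W : R -> R -> Bicomplex)
         (a : nat -> Bicomplex),
    0 < b ->
    C2_on_segment b f df ddf ->
    (forall x : R, segment b x -> f x <> RtoC 0) ->
    f 0 = RtoC 1 ->
    Vekua_solution b f df W ->
    uniform_expansion b f a W ->
    forall n : nat,
      exists Wn : R -> R -> Bicomplex,
        is_Bers_derivative b f W n Wn /\
        a n = (BC (RtoC (/ INR (fact n))) * Wn 0 0)%B.
Proof.
  intros b f df ddf W a Hb Hf Hn0 H1 _ HW n.
  pose proof (formal_powers_generating_system b f df ddf Hb Hf Hn0 H1) as G.
  destruct (expansion_coefficients_converge _ _ _ _ _ _ G HW) as [Hc Hd].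
  exists (bers_series f (A_pow f) (B_pow f) (Nat.iter n shift_coeffs (plus_part a))
            (Nat.iter n shift_coeffs (minus_part a)) n).
  split.
  - induction n as [|n IH].
    + intros x t Hxt; eapply expansion_is_bers_series; eassumption.
    + eexists; split; [exact IH|].
      eapply bers_series_step; [exact G | |]; apply converges_below_iter_shift; assumption.
  - pose proof RtoC_2_neq_0 as H2.
    assert (Hfact : RtoC (INR (fact n)) <> RtoC 0).
    { intros E; apply (f_equal fst) in E; exact (INR_fact_neq_0 n E). }
    rewrite (surjective_pairing (a n)), (bers_series_origin _ _ _ _ _ _ _ _ _ G),
      !iter_shift_coeffs_0.
    unfold plus_part, minus_part, BC, Bmult; simpl fst; simpl snd.
    rewrite (RtoC_inv (INR (fact n)) (INR_fact_neq_0 n)), (RtoC_inv 2 ltac:(lra)).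
    apply f_equal2; field; repeat split; assumption.
Qed.
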